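(* Let $\mu>0$. Let $A_+,A_-,B_+,B_-$ be real numbers with $A_\pm>B_\pm\geq\sqrt{2e^{\mu}}$, and let $c_+,c_->0$. Define $\eta:=\eta_++\eta_-:\mathbb{R}^2\to[0,+\infty)$, where $$\eta_\pm(t_2,t_3):=\chi_{(B_\pm^2,+\infty)}(e^{\pm t_2}+e^{\pm t_3})\,e^{f_\pm(t_2,t_3)},\qquad f_\pm(t_2,t_3):=\frac{c_\pm}{A_\pm^2-B_\pm^2}-\frac{c_\pm}{e^{\pm t_2}+e^{\pm t_3}-B_\pm^2}$$ ($\eta_\pm$ being understood to be $0$ where the characteristic function vanishes). In other words, for $(z_2,z_3)\in\mathbb{C}^*\times\mathbb{C}^*$, $$\eta(\log|z_2|^2,\log|z_3|^2)=\chi_{(B_+^2,+\infty)}(|z_2|^2+|z_3|^2)\,\exp\left(\frac{c_+}{A_+^2-B_+^2}\,\frac{|z_2|^2+|z_3|^2-A_+^2}{|z_2|^2+|z_3|^2-B_+^2}\right)+\chi_{(B_-^2,+\infty)}(|z_2|^{-2}+|z_3|^{-2})\,\exp\left(\frac{c_-}{A_-^2-B_-^2}\,\frac{|z_2|^{-2}+|z_3|^{-2}-A_-^2}{|z_2|^{-2}+|z_3|^{-2}-B_-^2}\right).$$ Then $\mathcal{W}_\eta$ is a smoothly bounded domain in $\mathbb{C}^3$ that contains $\mathcal{W}'_\mu$ (and is contained in $\mathcal{W}'_{\mu'}$ for every $\mu'$ with $\mu'\geq2\log A_+$ and $\mu'\geq 2\log A_-$). Moreover (with $A_\pm,B_\pm$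 fixed), there exists $C_+\geq A_+^2$ such that, for every $c_+>C_+$, there exists $C_-=C_-(c_+)\geq A_-^2$ such that, for every $c_->C_-$, the domain $\mathcal{W}_\eta$ is pseudoconvex.
   Context: $\mathbb{C}^*:=\mathbb{C}\setminus\{0\}$; $\chi_S$ denotes the characteristic function of a set $S$. A domain is a nonempty connected open subset of $\mathbb{C}^3$. For an upper semicontinuous $\eta:\mathbb{R}^2\to[0,+\infty)$, $$\mathcal{W}_\eta=\left\{(z_1,z_2,z_3)\in\mathbb{C}\times\mathbb{C}^*\times\mathbb{C}^*:\ \left|z_1-e^{i\log|z_2z_3|^2}\right|^2<1-\eta(\log|z_2|^2,\log|z_3|^2)\right\}.$$ For $\nu>0$, $\mathcal{W}'_\nu:=\mathcal{W}_{\chi_{C_\nu}}$ with $C_\nu:=\mathbb{R}^2\setminus\big((-\nu,\nu)\times(-\nu,\nu)\big)$, i.e. $\mathcal{W}'_\nu=\{(z_1,z_2,z_3)\in\mathbb{C}\times\mathbb{C}^*\times\mathbb{C}^*:\ |z_1-e^{i\log|z_2z_3|^2}|<1,\ -\nu<\log|z_2|^2<\nu,\ -\nu<\log|z_3|^2<\nu\}$. *)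

(* Defs.v *)
From HB Require Import structures.
From mathcomp Require Import all_boot all_order all_algebra.
From mathcomp Require Import all_classical all_reals all_analysis.
From mathcomp Require Import complex ring lra.
Import Order.TTheory GRing.Theory Num.Theory.
Import numFieldNormedType.Exports.

Set Implicit Arguments.
Unset Strict Implicit.
Unset Printing Implicit Defensive.

Local Open Scope classical_set_scope.
Local Open Scope ring_scope.
Local Open Scope complex_scope.

(* The metric of the modulus on R[i]; it makes 'rV[R[i]]_n a normed space over
   R[i] with the sup norm.  The normed-module structure of R[i]^o is not copied
   to R[i], as it would hide the R-module structure of R[i]. *)
HB.instance Definition _ (R : realType) :=
  PseudoPointedMetric.copy R[i] R[i]^o.

Notation cmod := ComplexField.Normc.normc.

Definition expi {R : realType} (x : R) : R[i] := cos x +i* sin x.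

Section ComplexSpace.
Context {R : realType} {n : nat}.
Local Notation Cn := 'rV[R[i]]_n.

Definition is_domain (Omega : set Cn) : Prop :=
  [/\ Omega !=set0, open Omega & connected Omega].

(* Directional derivatives are real ones: the parameter t ranges over R, so that
   v ranges over all 2n real directions (and their combinations). *)
Definition rderivable (f : Cn -> R) (z v : Cn) : Prop :=
  derivable (fun t : R => f (z + t%:C *: v)) 0 1.

Definition rderive (f : Cn -> R) (z v : Cn) : R :=
  derive1 (fun t : R => f (z + t%:C *: v)) 0.

(* Meaningful for U open. *)
Fixpoint Ck_on (k : nat) (U : set Cn) (f : Cn -> R) : Prop :=
  (forall z, U z -> {for z, continuous f}) /\
  if k is k'.+1 then
    forall v : Cn, (forall z, U z -> rderivable f z v) /\
                   Ck_on k' U (fun z => rderive f z v)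
  else True.

Definition smooth_on (U : set Cn) (f : Cn -> R) : Prop :=
  forall k, Ck_on k U f.

Definition boundary (Omega : set Cn) : set Cn := closure Omega `\` Omega°.

Definition has_smooth_boundary (Omega : set Cn) : Prop :=
  exists (U : set Cn) (r : Cn -> R),
    [/\ open U, boundary Omega `<=` U, smooth_on U r,
        Omega `&` U = [set z | U z /\ r z < 0] &
        forall z, boundary Omega z -> exists v, rderive r z v != 0].

Definition smoothly_bounded_domain (Omega : set Cn) : Prop :=
  [/\ is_domain Omega, bounded_set Omega & has_smooth_boundary Omega].

(* Plurisubharmonicity, for continuous real-valued functions: sub-mean value
   inequality on every closed disc of a complex line that lies in Omega. *)
Definition continuous_psh (Omega : set Cn) (u : Cn -> R) : Prop :=
  (forall z, Omega z -> {for z, continuous u}) /\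
  forall z w : Cn,
    (forall tau : R[i], cmod tau <= 1 -> Omega (z + tau *: w)) ->
    u z <= (2 * pi)^-1 *
           \int[lebesgue_measure]_(x in `[0, 2 * pi]) u (z + expi x *: w).

(* Existence of a continuous plurisubharmonic exhaustion function. *)
Definition pseudoconvex (Omega : set Cn) : Prop :=
  exists u : Cn -> R, continuous_psh Omega u /\
    forall c : R, compact [set z | Omega z /\ u z <= c].

End ComplexSpace.

Section Worm.
Context {R : realType}.

(* Upper semicontinuity of eta makes this set open; the definition itself does
   not use it. *)
Definition worm (eta : R -> R -> R) : set 'rV[R[i]]_3 :=
  [set z | [/\ z 0 1 != 0, z 0 2 != 0 &
     cmod (z 0 0 - expi (ln (cmod (z 0 1 * z 0 2) ^+ 2))) ^+ 2
       < 1 - eta (ln (cmod (z 0 1) ^+ 2)) (ln (cmod (z 0 2) ^+ 2))]].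

Definition worm_box (nu : R) : set 'rV[R[i]]_3 :=
  worm (fun t2 t3 => \1_(~` (`]- nu, nu[ `*` `]- nu, nu[)) (t2, t3)).

(* f_+- and eta_+- as functions of s = e^(+-t2) + e^(+-t3).  The division by
   zero at s = B^2 is harmless, since the indicator vanishes there. *)
Definition cutoff_exponent (A B c s : R) : R :=
  c / (A ^+ 2 - B ^+ 2) - c / (s - B ^+ 2).

Definition cutoff (A B c s : R) : R :=
  \1_(`]B ^+ 2, +oo[) s * expR (cutoff_exponent A B c s).

Definition worm_eta (Ap Bp cp Am Bm cm t2 t3 : R) : R :=
  cutoff Ap Bp cp (expR t2 + expR t3) +
  cutoff Am Bm cm (expR (- t2) + expR (- t3)).

Lemma cmod_gt0 (z : R[i]) : z != 0 -> 0 < cmod z.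
Proof.
move=> z0; have : 0 < `|z| by rewrite normr_gt0.
by rewrite normc_def ltcR; case: z {z0}.
Qed.

Lemma worm_boxE (nu : R) : worm_box nu =
  [set z | [/\ z 0 1 != 0, z 0 2 != 0,
     cmod (z 0 0 - expi (ln (cmod (z 0 1 * z 0 2) ^+ 2))) < 1,
     - nu < ln (cmod (z 0 1) ^+ 2) < nu &
     - nu < ln (cmod (z 0 2) ^+ 2) < nu]].
Proof.
have cge0 (w : R[i]) : 0 <= cmod w by case: w => a b; rewrite sqrtr_ge0.
apply/seteqP; split => z /=.
  case=> z1 z2; rewrite indicE; case: (boolP (_ \in _)).
    by rewrite subrr ltNge sqr_ge0.
  rewrite notin_setE/= subr0 => /contrapT[]/=; rewrite !in_itv/= => h1 h2 h.
  by split=> //; move: h; rewrite expr_lt1.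
case=> z1 z2 h h1 h2; split=> //; rewrite indicE memNset ?subr0 ?expr_lt1//.
by apply; split; rewrite /= in_itv.
Qed.

Lemma worm_eta_ge0 (Ap Bp cp Am Bm cm t2 t3 : R) :
  0 <= worm_eta Ap Bp cp Am Bm cm t2 t3.
Proof. by rewrite addr_ge0// mulr_ge0 ?expR_ge0// indicE ler0n. Qed.

Lemma worm_eta_logE (Ap Bp cp Am Bm cm : R) (z2 z3 : R[i]) :
  0 < Bp < Ap -> 0 < Bm < Am -> z2 != 0 -> z3 != 0 ->
  worm_eta Ap Bp cp Am Bm cm (ln (cmod z2 ^+ 2)) (ln (cmod z3 ^+ 2)) =
  (let s := cmod z2 ^+ 2 + cmod z3 ^+ 2 in
   \1_(`]Bp ^+ 2, +oo[) s *
   expR (cp / (Ap ^+ 2 - Bp ^+ 2) * ((s - Ap ^+ 2) / (s - Bp ^+ 2)))) +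
  (let s := cmod z2 ^- 2 + cmod z3 ^- 2 in
   \1_(`]Bm ^+ 2, +oo[) s *
   expR (cm / (Am ^+ 2 - Bm ^+ 2) * ((s - Am ^+ 2) / (s - Bm ^+ 2)))).
Proof.
move=> hp hm z20 z30; rewrite /worm_eta !expRN !lnK ?posrE ?exprn_gt0 ?cmod_gt0//.
suff H A B c s : 0 < B < A -> cutoff A B c s = \1_(`]B ^+ 2, +oo[) s *
    expR (c / (A ^+ 2 - B ^+ 2) * ((s - A ^+ 2) / (s - B ^+ 2))).
  by rewrite !H.
move=> /andP[B0 BA]; rewrite /cutoff /cutoff_exponent indicE.
case: (boolP (_ \in _)); last by rewrite !mul0r.
rewrite inE/= in_itv/= andbT => Bs; congr (_ * expR _).
have ? : A ^+ 2 - B ^+ 2 != 0 by rewrite subr_eq0 gt_eqF// ltrXn2r ?ltW// nnegrE; lra.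
have ? : s - B ^+ 2 != 0 by rewrite subr_eq0 gt_eqF.
by field; apply/andP.
Qed.

End Worm.

(* Main.v *)
Require Import Defs.
From HB Require Import structures.
From mathcomp Require Import all_boot all_order all_algebra.
From mathcomp Require Import all_classical all_reals all_analysis.
From mathcomp Require Import complex ring lra.
Import Order.TTheory GRing.Theory Num.Theory.
Import numFieldNormedType.Exports.

Set Implicit Arguments.
Unset Strict Implicit.
Unset Printing Implicit Defensive.

Local Open Scope classical_set_scope.
Local Open Scope ring_scope.

(** Off the coordinate axes write a = z_1, t_j = log|z_j|^2 and
    theta = t_2 + t_3.  The worm is the set where the gap
      P = 1 - eta - |a - e^(i theta)|^2
        = 2 Re(a e^(- i theta)) - |a|^2 - eta_+ - eta_-
    is positive, and P is smooth there: the cutoffs are of the form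
    exp(K - c / x) for x > 0, extended by 0, and all their derivatives vanish
    at x = 0.

    Bounded domain.  Where eta < 1 both cutoffs are smaller than 1, and since
    they increase this bounds |z_2|^2 + |z_3|^2 by A_+^2 and the sum of the
    inverses by A_-^2; so the closure of the worm avoids the axes.  On a ray
    r |-> (r t_2, r t_3) the sums e^(+-r t_2) + e^(+-r t_3) are convex in r
    and equal 2 <= B^2 at r = 0, hence eta is nondecreasing along the ray.
    Shrinking log-moduli, arguments and a - e^(i theta) together therefore
    joins each point to (1, 1, 1) inside the worm.  At a boundary point
    P = 0: either a <> e^(i theta), and P has a nonzero derivative in a, or
    a = e^(i theta) and eta = 1, and the derivative of eta along the ray is
    positive, because t e^t >= e^t - 1.

    Pseudoconvexity.  The exhaustion is u = - log P.  Along a complex line the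
    t_j are harmonic; let lambda be a harmonic conjugate of theta, so that
    theta + i lambda is holomorphic.  Since lambda is harmonic, u is
    subharmonic as soon as - e^lambda P is, because
    - log P = lambda - log(e^lambda P) and - log is convex and decreasing.
    Moreover e^lambda P is 2 Re(a e^(- i (theta + i lambda))), which is
    harmonic, minus e^lambda |a|^2, which is the squared modulus of a
    holomorphic function, minus e^lambda eta_+- .  For the last terms,
    multiplying out gives
      e^(- lambda) Lap(e^lambda h(s)) =
        h''|grad s|^2 + h' Lap s + 2 h' grad lambda . grad s + |grad lambda|^2 h,
    and for the cutoff h the terms that can be negative are absorbed by
    (c / x^2)^2 |grad s|^2 and (c / x^2) Lap s when c is large; this uses that
    e^(+-t_j) is bounded below by A_-^(-2), respectively A_+^(-2), on the worm
    (cutoff_twisted_laplacian_ge0).  The conjugate lambda is multivalued, but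
    only its gradient enters, so that everything is phrased as an inequality
    between the derivatives of P (gap_levi_form).

    The sub-mean value inequality is obtained from Lap u >= 0 in the
    coordinate zeta = y + i x with tau = e^zeta: the integral over x of
    u(z + e^zeta w) is a convex function of y, since the second x-derivative
    integrates to 0 over a period, and it is bounded as y -> -oo; hence it is
    nondecreasing, and letting y -> -oo and y -> 0 gives the inequality
    (sub_mean_value). *)

(** * Real and imaginary parts of the coordinates *)

Section Coordinates.
Context {R : realType}.
Local Notation C := (R[i]).

Lemma Re_continuous : continuous (@complex.Re R : C -> R).
Proof.
move=> z A /nbhs_ballP[e e0 eA]; apply/nbhs_ballP; exists (e%:C)%C;
  first by rewrite /= ltcR.
move=> w; rewrite /ball/= => h; apply: eA; rewrite /ball/=.
by have := le_lt_trans (normc_ge_Re (z - w)) h; rewrite ltcR raddfB.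
Qed.

Lemma Im_continuous : continuous (@complex.Im R : C -> R).
Proof.
move=> z A /nbhs_ballP[e e0 eA]; apply/nbhs_ballP; exists (e%:C)%C;
  first by rewrite /= ltcR.
move=> w; rewrite /ball/= => h; apply: eA; rewrite /ball/=.
have : `|complex.Im (z - w)|%:C%C <= `|z - w|.
  have -> : `|complex.Im (z - w)| = `|complex.Re ((z - w) * 'i%C)|
    by rewrite ReiNIm normrN.
  apply: (le_trans (normc_ge_Re _)); rewrite normrM.
  by rewrite [X in _ * X]normc_def /= expr0n expr1n add0r sqrtr1 mulr1.
by move=> /le_lt_trans => /(_ _ h); rewrite ltcR raddfB.
Qed.

Lemma normc_le_ReIm (z : C) : `|z| <= (`|complex.Re z| + `|complex.Im z|)%:C%C.
Proof.
rewrite normc_def lecR -[leRHS]ger0_norm ?addr_ge0// -sqrtr_sqr ler_wsqrtr//.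
rewrite sqrrD !real_normK ?num_real// -addrA lerD2l lerDr mulrn_wge0 // mulr_ge0 //.
Qed.

Lemma cvg_complex {T : Type} (F : set_system T) {FF : Filter F} (f : T -> C) (l : C) :
  complex.Re (f x) @[x --> F] --> complex.Re l ->
  complex.Im (f x) @[x --> F] --> complex.Im l -> f x @[x --> F] --> l.
Proof.
move=> /cvgrPdist_lt hr /cvgrPdist_lt hi A /nbhs_ballP[e e0 eA].
have /complex_realP[r re] : e \is Num.real by exact: gtr0_real.
move: e0 eA; rewrite {e}re => r0 eA.
rewrite /= ltcR in r0.
have r20 : 0 < r / 2 by rewrite divr_gt0.
change (\forall x \near F, A (f x)).
near=> x; apply: eA; rewrite /ball/=.
apply: (le_lt_trans (normc_le_ReIm _)).
rewrite ltcR !raddfB (splitr r).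
by apply: ltrD; near: x; [exact: hr|exact: hi].
Unshelve. all: by end_near.
Qed.

Lemma cvg_row {T : Type} {U : nbhsType} {n : nat} (F : set_system T) {FF : Filter F}
    (f : T -> 'rV[U]_n) (l : 'rV[U]_n) :
  (forall j, f x 0 j @[x --> F] --> l 0 j) -> f x @[x --> F] --> l.
Proof.
move=> h A [P lP PA].
change (\forall x \near F, A (f x)).
have : \forall x \near F, forall j, P 0 j (f x 0 j).
  by apply: filter_forall => j; exact: (h j _ (lP 0 j)).
by apply: filterS => x hx; apply: PA => i j; rewrite ord1; exact: hx.
Qed.

Lemma row_coord_continuous {n} (j : 'I_n) : continuous (fun z : 'rV[C]_n => z 0 j).
Proof. exact: (@coord_continuous C). Qed.

Lemma Re_realM (t : R) (w : C) : complex.Re (t%:C%C * w) = t * complex.Re w.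
Proof. by case: w => c d; simpc. Qed.

Lemma Im_realM (t : R) (w : C) : complex.Im (t%:C%C * w) = t * complex.Im w.
Proof. by case: w => c d; simpc. Qed.

Lemma line_continuous {n} (z v : 'rV[C]_n) :
  continuous (fun t : R => z + t%:C%C *: v).
Proof.
move=> t; apply: cvg_row => j.
under eq_fun do rewrite !mxE.
rewrite !mxE; apply: cvg_complex; under eq_fun do rewrite raddfD/=.
  rewrite raddfD/= Re_realM; under eq_fun do rewrite Re_realM.
  by apply: cvgD; [exact: cvg_cst|apply: cvgMl; exact: cvg_id].
rewrite raddfD/= Im_realM; under eq_fun do rewrite Im_realM.
by apply: cvgD; [exact: cvg_cst|apply: cvgMl; exact: cvg_id].
Qed.

Lemma Re_coord_continuous {n} (j : 'I_n) :
  continuous (fun z : 'rV[C]_n => complex.Re (z 0 j)).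
Proof.
by move=> z; apply: (@continuous_comp _ _ _ (fun z : 'rV[C]_n => z 0 j));
  [exact: row_coord_continuous|exact: Re_continuous].
Qed.

Lemma Im_coord_continuous {n} (j : 'I_n) :
  continuous (fun z : 'rV[C]_n => complex.Im (z 0 j)).
Proof.
by move=> z; apply: (@continuous_comp _ _ _ (fun z : 'rV[C]_n => z 0 j));
  [exact: row_coord_continuous|exact: Im_continuous].
Qed.
End Coordinates.

(** * Calculus of functions of class C^k on open sets of C^n *)

Section SmoothCalculus.
Context {R : realType} {n : nat}.
Local Notation Cn := 'rV[R[i]]_n.
Implicit Types (U : set Cn) (f g : Cn -> R) (z v : Cn).

(** The restriction of f to a real line, parametrized so that z is at 0: the
    directional derivative at z is its derivative at 0. *)
Definition ray z v f := (fun t : R => f (z + t%:C%C *: v)).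

Lemma ray0 z v : z + (0 : R)%:C%C *: v = z.
Proof. by rewrite scale0r addr0. Qed.

Lemma rayE0 z v f : ray z v f 0 = f z.
Proof. by rewrite /ray ray0. Qed.

Lemma rderive_def f z v (d : R) : is_derive (0 : R) (1 : R) (ray z v f) d ->
  rderivable f z v /\ rderive f z v = d.
Proof. by move=> [h1 h2]; split;
  [exact: h1|rewrite /rderive derive1E; exact: h2]. Qed.

Lemma rderivableP f z v : rderivable f z v ->
  is_derive (0 : R) (1 : R) (ray z v f) (rderive f z v).
Proof. by move=> h; apply: DeriveDef; [exact: h|rewrite /rderive derive1E]. Qed.

Lemma near_line U z v : open U -> U z -> \forall t \near (0 : R), U (z + t%:C%C *: v).
Proof.
move=> oU Uz; have := @line_continuous R n z v 0; apply.
by apply: open_nbhs_nbhs; rewrite ray0.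
Qed.

(** Directional derivatives are local, so formulas valid on an open set can be
    differentiated again. *)
Lemma eq_rderive U f g : open U -> {in U, f =1 g} ->
  forall z v, U z -> rderivable f z v -> rderivable g z v /\
    rderive g z v = rderive f z v.
Proof.
move=> oU fg z v Uz /rderivableP df; apply: rderive_def.
apply: near_eq_is_derive df.
near=> t; rewrite /ray fg// inE; near: t.
exact: near_line.
Unshelve. all: by end_near.
Qed.

Lemma eq_for_continuous U f g : open U -> {in U, f =1 g} -> forall z, U z ->
  {for z, continuous f} -> {for z, continuous g}.
Proof.
move=> oU fg z Uz cf; change (g x @[x --> z] --> g z); rewrite -fg ?inE//.
apply: cvg_trans cf; apply: (@near_eq_cvg _ _ (nbhs z) _ f g).
have H : nbhs z U by exact: open_nbhs_nbhs.
by apply: filterS H => w Uw; rewrite fg ?inE.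
Unshelve. all: by end_near.
Qed.

Lemma eq_Ck_on k : forall U f g, open U -> {in U, f =1 g} -> Ck_on k U f ->
  Ck_on k U g.
Proof.
elim: k => [|k IH] U f g oU fg /= [cf df].
  by split=> // z Uz; exact: (@eq_for_continuous U f g oU fg z Uz (cf z Uz)).
split; first by move=> z Uz; exact: (@eq_for_continuous U f g oU fg z Uz (cf z Uz)).
move=> v; have [df1 df2] := df v; split.
  by move=> z Uz; have [] := @eq_rderive U f g oU fg z v Uz (df1 z Uz).
apply: IH df2 => // z; rewrite inE => Uz.
by have [_ ->] := @eq_rderive U f g oU fg z v Uz (df1 z Uz).
Qed.

Lemma Ck_on_continuous k U f : Ck_on k U f -> forall z, U z -> {for z, continuous f}.
Proof. by case: k => [|k] []. Qed.

Lemma Ck_onW k : forall U f, Ck_on k.+1 U f -> Ck_on k U f.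
Proof.
elim: k => [|k IH] U f [cf df]; first by split.
by split=> // v; have [df1 df2] := df v; split=> //; exact: IH.
Qed.

(** The way to climb from C^k to C^(k+1): exhibit the derivatives as named C^k
    functions. *)
Lemma Ck_onS k U f (D : Cn -> Cn -> R) : open U ->
  (forall z, U z -> {for z, continuous f}) ->
  (forall z v, U z -> is_derive (0 : R) (1 : R) (ray z v f) (D v z)) ->
  (forall v, Ck_on k U (D v)) -> Ck_on k.+1 U f.
Proof.
move=> oU cf df ck; split=> // v; split.
  by move=> z Uz; have [] := rderive_def (df z v Uz).
apply: eq_Ck_on (ck v) => // z; rewrite inE => Uz.
by have [_ ->] := rderive_def (df z v Uz).
Qed.

Lemma Ck_on_is_derive k U f z v : Ck_on k.+1 U f -> U z ->
  is_derive (0 : R) (1 : R) (ray z v f) (rderive f z v).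
Proof. by move=> [_ df] Uz; apply: rderivableP; have [df1 _] := df v; exact: df1. Qed.

Lemma Ck_on_rderive k U f v : Ck_on k.+1 U f -> Ck_on k U (rderive f ^~ v).
Proof. by move=> [_ df]; have [_] := df v. Qed.

Lemma Ck_on_cst k U (c : R) : open U -> Ck_on k U (fun=> c).
Proof.
move=> oU; elim: k c => [|k IH] c; first by split=> // z _; exact: cst_continuous.
apply: (@Ck_onS _ _ _ (fun _ _ => 0)) => //.
- by move=> z _; exact: cst_continuous.
- by move=> z v _; exact: is_derive_cst.
Qed.

Lemma Ck_on_linear k U (l : Cn -> R) : open U -> continuous l ->
  (forall z v (t : R), l (z + t%:C%C *: v) = l z + t * l v) -> Ck_on k U l.
Proof.
move=> oU cl ll; case: k => [|k]; first by split=> // z _; exact: cl.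
apply: (@Ck_onS _ _ _ (fun v _ => l v)) => //; last by move=> v; exact: Ck_on_cst.
  by move=> z _; exact: cl.
move=> z v _; have -> : ray z v l = cst (l z) + (l v) \*: id.
  by apply/funext => t; rewrite /ray ll mulrC.
by apply: is_derive_eq; rewrite add0r scaler1.
Qed.

Lemma Ck_on_Re k U j : open U -> Ck_on k U (fun z => complex.Re (z 0 j)).
Proof.
move=> oU; apply: Ck_on_linear => //; first exact: Re_coord_continuous.
by move=> z v t; rewrite !mxE raddfD/= Re_realM.
Qed.

Lemma Ck_on_Im k U j : open U -> Ck_on k U (fun z => complex.Im (z 0 j)).
Proof.
move=> oU; apply: Ck_on_linear => //; first exact: Im_coord_continuous.
by move=> z v t; rewrite !mxE raddfD/= Im_realM.
Qed.

Lemma Ck_on_add k : forall U f g, open U -> Ck_on k U f -> Ck_on k U g ->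
  Ck_on k U (fun z => f z + g z).
Proof.
elim: k => [|k IH] U f g oU Cf Cg.
  by split=> // z Uz; exact: (cvgD (Ck_on_continuous Cf Uz) (Ck_on_continuous Cg Uz)).
apply: (@Ck_onS _ _ _ (fun v z => rderive f z v + rderive g z v)) => //.
- by move=> z Uz; exact: (cvgD (Ck_on_continuous Cf Uz) (Ck_on_continuous Cg Uz)).
- move=> z v Uz; exact: (is_deriveD (Ck_on_is_derive v Cf Uz)
    (Ck_on_is_derive v Cg Uz)).
- by move=> v; apply: IH => //; exact: Ck_on_rderive.
Qed.

Lemma Ck_on_mul k : forall U f g, open U -> Ck_on k U f -> Ck_on k U g ->
  Ck_on k U (fun z => f z * g z).
Proof.
elim: k => [|k IH] U f g oU Cf Cg.
  by split=> // z Uz; exact: (cvgM (Ck_on_continuous Cf Uz) (Ck_on_continuous Cg Uz)).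
apply: (@Ck_onS _ _ _ (fun v z => f z * rderive g z v + g z * rderive f z v)) => //.
- by move=> z Uz; exact: (cvgM (Ck_on_continuous Cf Uz) (Ck_on_continuous Cg Uz)).
- move=> z v Uz; have := is_deriveM (Ck_on_is_derive v Cf Uz)
    (Ck_on_is_derive v Cg Uz).
  by rewrite !rayE0.
- move=> v; apply: Ck_on_add => //; apply: IH => //;
    first [exact: Ck_onW|exact: Ck_on_rderive].
Qed.

(** Smoothness of a function of one variable is given by the family phi of its
    successive derivatives on V; all members of the family are treated at once,
    because the derivative of phi m o f involves phi m.+1 o f. *)
Lemma Ck_on_comp (phi : nat -> R -> R) (V : set R)  k U f : open U ->
  (forall m x, V x -> is_derive x (1 : R) (phi m) (phi m.+1 x)) ->
  (forall z, U z -> V (f z)) ->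
  Ck_on k U f -> forall m, Ck_on k U (fun z => phi m (f z)).
Proof.
move=> oU dphi UV; elim: k => [|k IH] Cf m.
  split=> // z Uz; apply: (continuous_comp (Ck_on_continuous Cf Uz)).
  by apply: differentiable_continuous; apply/derivable1_diffP; have [] :=
    dphi m _ (UV _ Uz).
apply: (@Ck_onS _ _ _ (fun v z => phi m.+1 (f z) * rderive f z v)) => //.
- move=> z Uz; apply: (continuous_comp (Ck_on_continuous Cf Uz)).
  by apply: differentiable_continuous; apply/derivable1_diffP; have [] :=
    dphi m _ (UV _ Uz).
- move=> z v Uz; have /= h := @is_derive1_comp R (phi m) (ray z v f) 0
    (phi m.+1 (f z)) (rderive f z v).
  apply: h; last exact: (Ck_on_is_derive v Cf Uz).
  by rewrite rayE0; exact: dphi (UV _ Uz).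
- by move=> v; apply: Ck_on_mul => //;
    [apply: IH; exact: Ck_onW|exact: Ck_on_rderive].
Qed.

End SmoothCalculus.

(** * Flat functions and the cutoff *)

Section FlatFunctions.
Context {R : realType}.
Implicit Types (p : {poly R}) (b c K s h : R).

(** Differentiability at the gluing point of a flat function. *)
Lemma is_derive0_of_quadratic (f : R -> R) (b M : R) :
  (forall h : R, `|h| <= 1 -> `|f (h + b) - f b| <= M * h ^+ 2) ->
  is_derive b (1 : R) f 0.
Proof.
move=> hM.
have cv : (fun h : R => h^-1 *: (f (h *: 1 + b) - f b)) @ 0^' --> (0 : R).
  have M0 : 0 <= M by have := hM 1; rewrite normr1 expr1n mulr1 => /(_ (lexx _));
    exact: le_trans.
  apply/cvgrPdist_le => e e0; near=> h.
  have h0 : h != 0 by near: h; exact: nbhs_dnbhs_neq.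
  have h1 : `|h| <= 1.
    near: h; apply: nbhs_dnbhs.
    by apply: filterS (@nbhs0_le _ R 1 ltr01) => z.
  have he : `|h| <= e / (M + 1).
    near: h; apply: nbhs_dnbhs.
    by apply: filterS (@nbhs0_le _ R (e / (M + 1)) _) => //;
      rewrite divr_gt0// ltr_wpDl.
  rewrite sub0r normrN /GRing.scale/= mulr1 normrM normfV.
  rewrite ler_pdivrMl ?normr_gt0//; apply: (le_trans (hM h h1)).
  rewrite -real_normK ?num_real// expr2 mulrCA ler_wpM2l//.
  have : M * `|h| <= (M + 1) * (e / (M + 1)) by rewrite ler_pM// lerDl.
  by rewrite mulrC [X in _ <= X]mulrC divfK ?gt_eqF ?ltr_wpDl// mulrC.
apply: DeriveDef; first by apply/cvg_ex; exists 0.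
exact: (cvg_lim _ cv).
Unshelve. all: by end_near.
Qed.

Lemma expR_ge_pow n (x : R) : 0 <= x -> (x / n%:R) ^+ n <= expR x.
Proof.
move=> x0; case: n => [|n]; first by rewrite expr0 -expR0 ler_expR.
have -> : expR x = expR (x / n.+1%:R) ^+ n.+1.
  by rewrite -expRM_natl mulrC divfK// pnatr_eq0.
rewrite lerXn2r ?nnegrE ?expR_ge0 ?divr_ge0//.
by apply: le_trans (expR_ge1Dx _); rewrite lerDr.
Qed.

(** The exponential wins over any power of h^-1, because
    e^(c / h) >= (c / (n h))^n. *)
Lemma poly_expRN_flat c p n : 0 < c -> exists2 M : R, 0 <= M &
  forall h, 0 < h -> `|p.[h^-1]| * expR (- (c / h)) <= M * h ^+ n.
Proof.
move=> c0; elim/poly_ind: p n => [|p a IH] n.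
  by exists 0 => // h h0; rewrite horner0 normr0 !mul0r.
have [M M0 hM] := IH n.+1.
exists (M + `|a| * (n%:R / c) ^+ n).
  by rewrite addr_ge0 ?mulr_ge0 ?exprn_ge0 ?divr_ge0// ltW.
move=> h h0; rewrite hornerMXaddC.
apply: (@le_trans _ _ (`|p.[h^-1]| * expR (- (c / h)) * h^-1 + `|a| * expR
  (- (c / h)))).
  rewrite [X in _ <= X + _]mulrAC -mulrDl ler_wpM2r ?expR_ge0//.
  apply: (le_trans (ler_normD _ _)); rewrite normrM lerD2r.
  by rewrite [`|h^-1|]ger0_norm ?invr_ge0// ltW.
rewrite mulrDl lerD//.
  by rewrite ler_pdivrMr// -mulrA -exprSr; exact: hM.
rewrite -mulrA ler_wpM2l// expRN -exprMn.
have q0 : 0 <= c / h by rewrite divr_ge0// ltW.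
have := expR_ge_pow n q0.
case: n {IH M M0 hM} => [|n]; first by rewrite !expr0 => _;
  rewrite invf_le1 ?expR_gt0// -expR0 ler_expR.
move=> H; rewrite -[leRHS]invrK lef_pV2 ?posrE ?expR_gt0 ?invr_gt0 ?exprn_gt0
  ?mulr_gt0 ?invr_gt0//.
apply: le_trans H; rewrite -exprVn le_eqVlt; apply/orP; left; apply/eqP;
  congr (_ ^+ _).
by rewrite invfM invf_div; ring.
Qed.

(** Functions P(1/x) exp(K - c/x) of x = s - b > 0, extended by 0: a class closed
    under differentiation, which acts on P by P |-> X^2 (c P - P'). *)
Definition flat K c b p s := if b < s then p.[(s - b)^-1] * expR (K - c / (s - b))
  else 0.

Definition dflat c p := 'X^2 * (c *: p - p^`()).

Lemma is_derive_flat K c b p s : 0 < c ->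
  is_derive s (1 : R) (flat K c b p) (flat K c b (dflat c p) s).
Proof.
move=> c0; case: (ltgtP s b) => [sb|bs|->].
- rewrite {2}/flat ltNge (ltW sb)/=.
  apply: (@near_eq_is_derive R R R (cst 0) _ s 1 0).
  near=> t; rewrite /flat ltNge ltW//=.
  by near: t; exact: lt_nbhsl.
- rewrite {2}/flat bs.
  apply: (@near_eq_is_derive R R R
    (fun t => (horner p \o (fun t => (t - b)^-1)) t *
    (expR \o (fun t => K - c * (t - b)^-1)) t)).
    near=> t; rewrite /flat ifT//.
    by near: t; exact: lt_nbhsr.
  have sb0 : s - b != 0 by rewrite subr_eq0 gt_eqF.
  have dV : is_derive s (1:R) (fun t => (t - b)^-1) (- (s - b) ^- 2).
    have d1 : is_derive s (1 : R) (fun t : R => t - b) 1.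
      by apply: is_derive_eq; rewrite subr0.
    have := @is_deriveV R (fun t : R => t - b) s 1 1 sb0 d1.
    by rewrite /GRing.scale/= mulr1.
  have d2 : is_derive s (1:R) (fun t => K - c * (t - b)^-1) (c * (s - b) ^- 2).
    have := is_deriveB (is_derive_cst K s (1:R)) (is_deriveZ c dV).
    by rewrite sub0r scalerN opprK.
  have d3 := @is_derive1_comp R (horner p) _ s _ _ (is_derive_poly p _) dV.
  have d4 := @is_derive1_comp R expR _ s _ _ (is_derive_expR _) d2.
  have H := is_deriveM d3 d4; apply: (is_derive_eq H).
  rewrite /dflat hornerM hornerXn hornerD hornerN hornerZ /GRing.scale/=.
  by rewrite -exprVn; ring.
- rewrite {2}/flat ltxx.
  have [M M0 hM] := poly_expRN_flat p 2 c0.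
  apply: (@is_derive0_of_quadratic _ _ (M * expR K)) => h _.
  rewrite /flat ltxx subr0 addrK; case: ifPn => [|_]; last first.
    by rewrite normr0 mulr_ge0 ?sqr_ge0// mulr_ge0 ?expR_ge0.
  rewrite -subr_gt0 addrK => h0.
  rewrite normrM [`|expR _|]ger0_norm ?expR_ge0// expRD.
  have := hM h h0; rewrite -(ler_pM2r (expR_gt0 K)); lra.
Unshelve. all: by end_near.
Qed.

End FlatFunctions.

Section Cutoff.
Context {R : realType}.
Implicit Types (A B c s : R).

(** The n-th derivative of the cutoff. *)
Definition cutoffD A B c n s :=
  flat (c / (A ^+ 2 - B ^+ 2)) c (B ^+ 2) (iter n (dflat c) 1) s.

Lemma cutoffD0 A B c : cutoffD A B c 0 = cutoff A B c.
Proof.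
apply/funext => s; rewrite /cutoffD /flat /cutoff /cutoff_exponent indicE/= hornerC.
case: ifPn => h; first by rewrite mem_set ?mul1r//= in_itv/= h.
by rewrite memNset ?mul0r//= in_itv/= andbT; exact/negP.
Qed.

Lemma is_derive_cutoffD A B c n s : 0 < c ->
  is_derive s (1 : R) (cutoffD A B c n) (cutoffD A B c n.+1 s).
Proof. exact: is_derive_flat. Qed.

Lemma cutoffD_le A B c n s : s <= B ^+ 2 -> cutoffD A B c n s = 0.
Proof. by move=> h; rewrite /cutoffD /flat ltNge h. Qed.

Lemma cutoffD1 A B c s : B ^+ 2 < s ->
  cutoffD A B c 1 s = c / (s - B ^+ 2) ^+ 2 * cutoff A B c s.
Proof.
move=> h; rewrite -cutoffD0 /cutoffD /flat h /= /dflat derivC subr0.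
by rewrite hornerM hornerXn hornerZ hornerC exprVn; ring.
Qed.

Lemma cutoffD2 A B c s : B ^+ 2 < s ->
  cutoffD A B c 2 s = (c ^+ 2 / (s - B ^+ 2) ^+ 4 - 2 * c / (s - B ^+ 2) ^+ 3) *
    cutoff A B c s.
Proof.
move=> h; rewrite -cutoffD0 /cutoffD /flat h /= /dflat derivC subr0 derivM derivZ
  derivC.
rewrite derivXn !(hornerE, hornerXn) /= exprVn.
have : s - B ^+ 2 != 0 by rewrite subr_eq0 gt_eqF.
by move=> h0; field.
Qed.

Lemma cutoffE A B c s : B ^+ 2 < s -> cutoff A B c s = expR (cutoff_exponent A B c s).
Proof.
by move=> h; rewrite /cutoff indicE mem_set ?mul1r//= in_itv/= h.
Qed.

Lemma cutoff_le A B c s : s <= B ^+ 2 -> cutoff A B c s = 0.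
Proof. by move=> h; rewrite -cutoffD0 cutoffD_le. Qed.

Lemma cutoff_ge0 A B c s : 0 <= cutoff A B c s.
Proof. by rewrite mulr_ge0 ?expR_ge0// indicE ler0n. Qed.

Lemma cutoff_homo A B c : 0 < c -> {homo cutoff A B c : s t / s <= t}.
Proof.
move=> c0 s t st; case: (leP s (B ^+ 2)) => hs.
  by rewrite cutoff_le// cutoff_ge0.
have ht := lt_le_trans hs st.
rewrite !cutoffE// ler_expR /cutoff_exponent lerD2l lerN2 ler_wpM2l ?(ltW c0)//.
by rewrite lef_pV2 ?posrE ?subr_gt0// lerD2r.
Qed.

Lemma cutoff_lt1 A B c s : 0 < c -> 0 < B < A -> cutoff A B c s < 1 -> s < A ^+ 2.
Proof.
move=> c0 /andP[B0 BA]; rewrite !ltNge; apply: contra => h.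
have AB : B ^+ 2 < A ^+ 2 by rewrite ltrXn2r ?nnegrE//; lra.
have := cutoff_homo A B c0 h; apply: le_trans.
by rewrite cutoffE// /cutoff_exponent subrr expR0.
Qed.

End Cutoff.

(** * Integrals over a period of families of functions *)

Section IntegralOverPeriod.
Context {R : realType}.
Local Notation mu := (@lebesgue_measure R).
Local Notation per := (`[0 : R, 2 * pi : R]%classic).
Implicit Types (f g : R -> R -> R) (D : set R).

Definition jointly_continuous D f :=
  forall y x, D y -> {for (y, x), continuous (fun q : R * R => f q.1 q.2)}.

Lemma twopi_gt0 : 0 < 2 * pi :> R.
Proof. by rewrite mulr_gt0 ?pi_gt0. Qed.

Lemma jointly_continuous_snd D f y :
  jointly_continuous D f -> D y -> continuous (f y).
Proof.
move=> jf Dy x.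
have c : {for x, continuous (fun x : R => (y, x))}
  by exact: (@cvg_pair _ _ _ (nbhs x) (nbhs y) (nbhs x) _ _ _ (fun=> y) id
  (cvg_cst y) cvg_id).
exact: (continuous_comp c (jf y x Dy)).
Qed.

Lemma jointly_continuous_fst D f y x :
  jointly_continuous D f -> D y -> {for y, continuous (f ^~ x)}.
Proof.
move=> jf Dy.
have c : {for y, continuous (fun y : R => (y, x))}
  by exact: (@cvg_pair _ _ _ (nbhs y) (nbhs y) (nbhs x) _ _ _ id (fun=> x) cvg_id
  (cvg_cst x)).
exact: (continuous_comp c (jf y x Dy)).
Qed.

Lemma jointly_continuous_bounded D f (a b : R) :
  jointly_continuous D f -> `[a, b]%classic `<=` D ->
  exists2 K, 0 <= K & forall y x, y \in `[a, b] -> x \in `[0, 2 * pi] ->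
    `|f y x| <= K.
Proof.
move=> jf abD.
have cpt : compact (`[a, b]%classic `*` per) by apply: compact_setX;
  exact: segment_compact.
have cf : {within `[a, b]%classic `*` per, continuous (fun q : R * R => f q.1 q.2)}.
  by apply: continuous_in_subspaceT => -[y x] /set_mem[/= hy _]; apply: jf;
    exact: abD.
have [M [_ hM]] := compact_bounded (continuous_compact cf cpt).
exists (`|M| + 1) => [|y x hy hx]; first by rewrite addr_ge0.
apply: (hM (`|M| + 1)); first by rewrite (le_lt_trans (ler_norm M))// ltrDl.
by exists (y, x).
Qed.

Lemma continuous_integrable_per (h : R -> R) :
  continuous h -> mu.-integrable per (EFin \o h).
Proof.
move=> ch; apply: continuous_compact_integrable; first exact: segment_compact.
exact: continuous_subspaceT.
Qed.

Definition period_integral f y := \int[mu]_(x in per) f y x.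

Lemma continuous_period_integral f :
  jointly_continuous setT f -> continuous (period_integral f).
Proof.
move=> jf y.
have [|K K0 hK] := @jointly_continuous_bounded setT f (y - 1) (y + 1) jf; first by [].
have := @continuity_under_integral R _ _ mu f per _ (y - 1) (y + 1) _ _ (cst K) _ _.
move=> /(_ _ _ _ _ _ y); apply.
- exact: measurable_itv.
- by move=> z _; apply: continuous_integrable_per; exact: jointly_continuous_snd jf _.
- by apply: aeW => x _ z _; exact: jointly_continuous_fst jf _.
- by apply: continuous_integrable_per => ?; exact: cst_continuous.
- move=> z hz; apply: aeW => x hx; apply: hK => //.
  by apply: subset_itv_oo_cc.
- by rewrite inE/= in_itv/= ltrBlDr ltrDl ltr01.
Qed.

Lemma is_derive_period_integral f g (a : R) :
  jointly_continuous [set y : R | y < 0] f ->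
  jointly_continuous [set y : R | y < 0] g ->
  (forall y x : R, y < 0 -> is_derive y (1 : R) (f ^~ x) (g y x)) ->
  a < 0 -> is_derive a (1 : R) (period_integral f) (period_integral g a).
Proof.
move=> jf jg df a0.
have [|K K0 hK] := @jointly_continuous_bounded _ g (2 * a) (a / 2) jg.
  by move=> y /=; rewrite in_itv/= => /andP[_ h]; apply: (le_lt_trans h);
    rewrite pmulr_llt0// invr_gt0.
have Ia : `]2 * a, a / 2[%classic a by rewrite /= in_itv/=; apply/andP; split; lra.
have I0 y : `]2 * a, a / 2[%classic y -> y < 0 by rewrite /= in_itv/= => /andP[_ h];
  lra.
have eqd y x : y < 0 -> partial1of2 f y x = g y x.
  by move=> y0; rewrite partial1of2E; have [_ ->] := df y x y0.
have mp : measurable per by exact: measurable_itv.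
have i1 y : `]2 * a, a / 2[%classic y -> mu.-integrable per (EFin \o f y).
  by move=> /I0 y0; apply: continuous_integrable_per;
    exact: (jointly_continuous_snd jf).
have i2 : mu.-integrable per (EFin \o cst K).
  by apply: continuous_integrable_per => ?; exact: cst_continuous.
have d1 y x : `]2 * a, a / 2[%classic y -> per x -> derivable (f ^~ x) y 1.
  by move=> /I0 y0 _; have [] := df y x y0.
have bd y x : `]2 * a, a / 2[%classic y -> per x -> `|partial1of2 f y x| <= cst K x.
  move=> Iy hx; rewrite eqd; last exact: I0.
  by apply: hK => //; exact: subset_itv_oo_cc.
apply: DeriveDef.
  exact: (@derivable_under_integral R _ _ mu f per mp a _ _ Ia i1 d1 (cst K) _ i2 bd).
rewrite -derive1E (@differentiation_under_integral R _ _ mu f per mp a _ _ Ia i1 d1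
  (cst K) _ i2 bd)//.
by apply: eq_Rintegral => x _; rewrite eqd.
Qed.

(** A periodic primitive makes the integral vanish: this is what removes the
    second derivative in the angle. *)
Lemma period_integral_derivative (h h' : R -> R) : continuous h' ->
  (forall x, is_derive x (1 : R) h (h' x)) -> h (2 * pi) = h 0 ->
  \int[mu]_(x in per) h' x = 0.
Proof.
move=> ch' dh hper; rewrite /Rintegral.
have ch : continuous h.
  by move=> x; apply: differentiable_continuous; apply/derivable1_diffP; have [] :=
    dh x.
rewrite (@continuous_FTC2 R h' h 0 (2 * pi) twopi_gt0); first by rewrite hper subee.
- exact: continuous_subspaceT.
- split=> [x _||]; first by have [] := dh x.
  + by apply: cvg_at_right_filter; exact: ch.
  + by apply: cvg_at_left_filter; exact: ch.
- by move=> x _; rewrite derive1E; have [_ ->] := dh x.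
Qed.

Lemma MVT_neg (m m' : R -> R) y1 y2 :
  (forall y : R, y < 0 -> is_derive y (1 : R) m (m' y)) ->
  y1 < y2 -> y2 < 0 -> exists2 c, y1 < c < y2 & m y2 - m y1 = m' c * (y2 - y1).
Proof.
move=> dm y12 y20.
have [||c cI e] := @MVT R m m' y1 y2 y12.
- by move=> x; rewrite in_itv/= => /andP[_ h]; apply: dm; exact: lt_trans y20.
- apply: derivable_within_continuous => x; rewrite in_itv/= => /andP[_ h].
  by have [] := dm x (le_lt_trans h y20).
- by move: cI; rewrite in_itv/= => cI; exists c.
Qed.

(** A negative slope at one point would force the convex function to tend to +oo
    at -oo. *)
Lemma bounded_convex_nondecreasing (m m1 m2 : R -> R) (K : R) :
  (forall y : R, y < 0 -> is_derive y (1 : R) m (m1 y)) ->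
  (forall y : R, y < 0 -> is_derive y (1 : R) m1 (m2 y)) ->
  (forall y : R, y < 0 -> 0 <= m2 y) ->
  (forall y : R, y < 0 -> m y <= K) ->
  forall y1 y2 : R, y1 < y2 -> y2 < 0 -> m y1 <= m y2.
Proof.
move=> dm dm1 m2ge0 mK.
have m1_homo y1 y2 : y1 < y2 -> y2 < 0 -> m1 y1 <= m1 y2.
  move=> y12 y20; have [c /andP[_ cy2] e] := MVT_neg dm1 y12 y20.
  by rewrite -subr_ge0 e mulr_ge0 ?subr_ge0 ?(ltW y12)// m2ge0// (lt_trans cy2).
have m1_ge0 y : y < 0 -> 0 <= m1 y.
  move=> y0; rewrite leNgt; apply/negP => m1y.
  (* at y' the tangent at y already exceeds K *)
  pose y' := y - (K - m y + 1) / (- m1 y).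
  have d0 : 0 < (K - m y + 1) / (- m1 y).
    by rewrite divr_gt0 ?oppr_gt0// ltr_wpDl// subr_ge0 mK.
  have y'y : y' < y by rewrite /y' ltrBlDr ltrDl.
  have [c /andP[y'c cy] e] := MVT_neg dm y'y y0.
  have m1c := m1_homo _ _ cy y0.
  have := mK y' (lt_trans y'y y0).
  have h1 : m1 c * (y - y') <= m1 y * (y - y') by rewrite ler_wpM2r// subr_ge0 ltW.
  have h2 : m1 y * (y - y') = - (K - m y + 1).
    by rewrite /y' opprB addrCA subrr addr0 invrN mulrN mulrN mulrCA divff ?mulr1//
      lt_eqF.
  by lra.
move=> y1 y2 y12 y20; have [c /andP[_ cy2] e] := MVT_neg dm y12 y20.
by rewrite -subr_ge0 e mulr_ge0 ?subr_ge0 ?(ltW y12)// m1_ge0// (lt_trans cy2).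
Qed.

(** The circular means of a bounded subharmonic function, in the logarithm y of
    the radius and the angle x, form a convex function of y. *)
Lemma period_integral_nondecreasing (g gy gyy gx gxx : R -> R -> R) (K : R) :
  let N := [set y : R | y < 0] in
  jointly_continuous N g -> jointly_continuous N gy -> jointly_continuous N gyy ->
    jointly_continuous N gxx ->
  (forall y x : R, y < 0 -> is_derive y (1 : R) (g ^~ x) (gy y x)) ->
  (forall y x : R, y < 0 -> is_derive y (1 : R) (gy ^~ x) (gyy y x)) ->
  (forall y x : R, y < 0 -> is_derive x (1 : R) (gx y) (gxx y x)) ->
  (forall y : R, y < 0 -> gx y (2 * pi) = gx y 0) ->
  (forall y x : R, y < 0 -> 0 <= gyy y x + gxx y x) ->
  (forall y x : R, y < 0 -> x \in `[0, 2 * pi] -> g y x <= K) ->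
  forall y1 y2 : R, y1 < y2 -> y2 < 0 -> period_integral g y1 <= period_integral g y2.
Proof.
move=> N jg jgy jgyy jgxx dg dgy dgx gper lap gK.
apply: (@bounded_convex_nondecreasing _ (period_integral gy) (period_integral gyy)
  (K * fine (mu per))).
- by move=> y y0; exact: is_derive_period_integral.
- by move=> y y0; exact: is_derive_period_integral.
- move=> y y0.
  have i1 := continuous_integrable_per (jointly_continuous_snd jgyy y0).
  have i2 := continuous_integrable_per (jointly_continuous_snd jgxx y0).
  have e : period_integral gxx y = 0.
    apply: (@period_integral_derivative (gx y));
      [exact: (jointly_continuous_snd jgxx)|by move=> x; exact: dgx|exact: gper].
  have -> : period_integral gyy y = period_integral gyy y + period_integral gxx y
    by rewrite e addr0.
  rewrite /period_integral -RintegralD//.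
  by apply: Rintegral_ge0 => x _; exact: lap.
- move=> y y0; rewrite -Rintegral_cst//.
  apply: le_Rintegral => //.
  + exact: continuous_integrable_per (jointly_continuous_snd jg y0).
  + by apply: continuous_integrable_per => ?; exact: cst_continuous.
  + by move=> x hx; exact: gK.
Qed.

End IntegralOverPeriod.

(** * The sub-mean value inequality from a nonnegative Laplacian *)

Section SubMeanValue.
Context {R : realType}.
Local Notation C := (R[i]).
Local Notation mu := (@lebesgue_measure R).

Lemma continuous_nondecreasing01 (N : R -> R) : continuous N ->
  (forall a b, 0 < a -> a < b -> b < 1 -> N a <= N b) -> N 0 <= N 1.
Proof.
move=> cN hN; rewrite leNgt; apply/negP => N10.
pose mid := (N 0 + N 1) / 2.
have m0 : mid < N 0 by rewrite /mid; lra.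
have m1 : N 1 < mid by rewrite /mid; lra.
near (0 : R)^'+ => a; near (1 : R)^'- => b.
have : N a <= N b.
  apply: hN; first by near: a; exact: nbhs_right_gt.
  - apply: (@lt_trans _ _ (1 / 2)); first by near: a; apply: nbhs_right_lt.
    by near: b; apply: nbhs_left_gt; lra.
  - by near: b; exact: nbhs_left_lt.
apply/negP; rewrite -ltNge; apply: (@lt_trans _ _ mid).
  near: b; have := cvg_at_left_filter (cN (1 : R)).
  by move=> /cvgr_lt; apply.
near: a; have := cvg_at_right_filter (cN (0 : R)).
by move=> /cvgr_gt; apply.
Unshelve. all: by end_near.
Qed.

(** C^1 as the space of row vectors of length 1, so that the calculus of C^k
    functions applies to functions of one complex variable. *)
Definition pt (y x : R) : 'rV[C]_1 := const_mx (y +i* x)%C.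

Lemma pt_ray1 y x t : pt y x + t%:C%C *: pt 1 0 = pt (t + y) x.
Proof. by apply/rowP => j; rewrite !mxE; simpc; rewrite addrC. Qed.

Lemma pt_rayi y x t : pt y x + t%:C%C *: pt 0 1 = pt y (t + x).
Proof. by apply/rowP => j; rewrite !mxE; simpc; rewrite [x + t]addrC. Qed.

Lemma is_derive_shift (h : R -> R) (y d : R) :
  is_derive (0 : R) (1 : R) (fun t => h (t + y)) d -> is_derive y (1 : R) h d.
Proof.
move=> dh.
have e : y - y = 0 by rewrite subrr.
have d1 : is_derive y (1 : R) (fun t : R => t - y) 1.
  by apply: is_derive_eq; rewrite subr0.
have := @is_derive1_comp R (fun t => h (t + y)) (fun t => t - y) y d 1.
rewrite e mulr1 => /(_ dh d1).
have -> : (fun t => h (t + y)) \o (fun t => t - y) = h by apply/funext => t /=;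
  rewrite subrK.
by [].
Qed.

Lemma is_derive_pt1 (f : 'rV[C]_1 -> R) y x d :
  is_derive (0 : R) (1 : R) (ray (pt y x) (pt 1 0) f) d ->
  is_derive y (1 : R) (fun s => f (pt s x)) d.
Proof.
move=> h; apply: is_derive_shift.
have -> : (fun t => f (pt (t + y) x)) = ray (pt y x) (pt 1 0) f; last by [].
by apply/funext => t; rewrite /ray pt_ray1.
Qed.

Lemma is_derive_pti (f : 'rV[C]_1 -> R) y x d :
  is_derive (0 : R) (1 : R) (ray (pt y x) (pt 0 1) f) d ->
  is_derive x (1 : R) (fun s => f (pt y s)) d.
Proof.
move=> h; apply: is_derive_shift.
have -> : (fun t => f (pt y (t + x))) = ray (pt y x) (pt 0 1) f; last by [].
by apply/funext => t; rewrite /ray pt_rayi.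
Qed.

Definition left_half_plane : set 'rV[C]_1 := [set zeta | complex.Re (zeta 0 0) < 0].

Lemma open_left_half_plane : open left_half_plane.
Proof.
rewrite (_ : left_half_plane = (fun zeta : 'rV[C]_1 => complex.Re (zeta 0 0)) @^-1`
  [set y | y < 0])//.
by apply: open_comp => [z _|]; [exact: Re_coord_continuous|exact: open_lt].
Qed.

Lemma pt_left y x : y < 0 -> left_half_plane (pt y x).
Proof. by move=> y0; rewrite /left_half_plane /= mxE. Qed.

Lemma continuous_pt : continuous (fun q : R * R => pt q.1 q.2).
Proof.
move=> q; apply: cvg_row => j; rewrite mxE; under eq_fun do rewrite mxE.
by apply: cvg_complex => /=; [exact: cvg_fst|exact: cvg_snd].
Qed.

Lemma jointly_continuous_pt (f : 'rV[C]_1 -> R) :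
  (forall zeta, left_half_plane zeta -> {for zeta, continuous f}) ->
  jointly_continuous [set y : R | y < 0] (fun y x => f (pt y x)).
Proof.
move=> cf y x y0.
exact: (continuous_comp (@continuous_pt (y, x)) (cf _ (pt_left x y0))).
Qed.

Definition cexp (zeta : C) : C :=
  (expR (complex.Re zeta))%:C%C * expi (complex.Im zeta).

Lemma cmod_expi (x : R) : cmod (expi x) = 1.
Proof. by rewrite /expi /= cos2Dsin2 sqrtr1. Qed.

Lemma cmod_real (r : R) : cmod (r%:C)%C = `|r|.
Proof. by rewrite /= expr0n addr0 sqrtr_sqr. Qed.

(** Radii are clamped to [0, 1] to obtain a function on the whole line: only the
    closed disc is known to lie in the domain. *)
Definition clamp (r : R) := Num.max 0 (Num.min 1 r).

Lemma clamp_id r : 0 <= r <= 1 -> clamp r = r.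
Proof. by move=> /andP[r0 r1]; rewrite /clamp min_r// max_r. Qed.

Lemma clamp_itv r : 0 <= clamp r <= 1.
Proof. by rewrite /clamp le_max lexx ge_max ler01 ge_min lexx. Qed.

Lemma continuous_clamp : continuous clamp.
Proof.
move=> r; apply: continuous_max; first exact: cvg_cst.
by apply: continuous_min; [exact: cvg_cst|exact: cvg_id].
Qed.

(** A continuous function with nonnegative Laplacian on the punctured open disc,
    the Laplacian being taken in the coordinate zeta = log tau, where it only
    changes by the positive factor |tau|^2. *)
Lemma sub_mean_value n (Omega : set 'rV[C]_n) (u : 'rV[C]_n -> R) (z w : 'rV[C]_n)
  (G := fun zeta : 'rV[C]_1 => u (z + cexp (zeta 0 0) *: w)) :
  (forall p, Omega p -> {for p, continuous u}) ->
  (forall tau : C, cmod tau <= 1 -> Omega (z + tau *: w)) ->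
  Ck_on 2 left_half_plane G ->
  (forall zeta, left_half_plane zeta ->
     0 <= rderive (rderive G ^~ (pt 1 0)) zeta (pt 1 0) +
          rderive (rderive G ^~ (pt 0 1)) zeta (pt 0 1)) ->
  u z <= (2 * pi)^-1 * \int[mu]_(x in `[0, 2 * pi]) u (z + expi x *: w).
Proof.
move=> cu disc CG lap.
pose f (r x : R) := u (z + ((clamp r)%:C%C * expi x) *: w).
have jf : jointly_continuous setT f.
  move=> r x _; rewrite /f.
  apply: (@continuous_comp _ _ _
    (fun q : R * R => z + ((clamp q.1)%:C%C * expi q.2) *: w) u); last first.
    apply: cu; apply: disc; rewrite ComplexField.Normc.normcM cmod_expi mulr1
      cmod_real.
    by have /andP[c0 c1] := clamp_itv r; rewrite ger0_norm.
  have c1 : {for (r, x), continuous (fun q : R * R => clamp q.1)}.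
    by apply: continuous_comp; [exact: cvg_fst|exact: continuous_clamp].
  have c2 : {for (r, x), continuous (fun q : R * R => cos q.2)}.
    by apply: continuous_comp; [exact: cvg_snd|exact: continuous_cos].
  have c3 : {for (r, x), continuous (fun q : R * R => sin q.2)}.
    by apply: continuous_comp; [exact: cvg_snd|exact: continuous_sin].
  apply: cvg_row => j; rewrite !mxE; under eq_fun do rewrite !mxE.
  apply: cvg_complex; under eq_fun do rewrite raddfD/= -mulrA.
    rewrite raddfD/= -mulrA Re_realM; under eq_fun do rewrite Re_realM.
    apply: cvgD; first exact: cvg_cst.
    apply: cvgM; first exact: c1.
    case: (w 0 j) => a b; rewrite /expi; simpc => /=.
    by apply: cvgB; apply: cvgMl.
  rewrite raddfD/= -mulrA Im_realM; under eq_fun do rewrite Im_realM.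
  apply: cvgD; first exact: cvg_cst.
  apply: cvgM; first exact: c1.
  case: (w 0 j) => a b; rewrite /expi; simpc => /=.
  by apply: cvgD; apply: cvgMl.
have cN := continuous_period_integral jf.
have cGy := Ck_on_rderive (pt 1 0) CG.
have cGx := Ck_on_rderive (pt 0 1) CG.
have gf y x : y < 0 -> G (pt y x) = f (expR y) x.
  move=> y0; rewrite /G /f mxE /cexp /= clamp_id// expR_ge0 /=.
  by rewrite -expR0 ler_expR ltW.
have [|K K0 hK] := @jointly_continuous_bounded R setT f 0 1 jf; first by [].
have mono : forall y1 y2 : R, y1 < y2 -> y2 < 0 ->
    period_integral (fun y x => G (pt y x)) y1 <= period_integral
      (fun y x => G (pt y x)) y2.
  apply: (@period_integral_nondecreasing R _
     (fun y x => rderive G (pt y x) (pt 1 0))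
     (fun y x => rderive (rderive G ^~ (pt 1 0)) (pt y x) (pt 1 0))
     (fun y x => rderive G (pt y x) (pt 0 1))
     (fun y x => rderive (rderive G ^~ (pt 0 1)) (pt y x) (pt 0 1)) K).
  - apply: jointly_continuous_pt; exact: Ck_on_continuous CG.
  - apply: (jointly_continuous_pt (f := rderive G ^~ (pt 1 0)));
      exact: Ck_on_continuous cGy.
  - apply: (jointly_continuous_pt (f := rderive (rderive G ^~ (pt 1 0)) ^~ (pt 1 0))).
    exact: Ck_on_continuous (Ck_on_rderive _ cGy).
  - apply: (jointly_continuous_pt (f := rderive (rderive G ^~ (pt 0 1)) ^~ (pt 0 1))).
    exact: Ck_on_continuous (Ck_on_rderive _ cGx).
  - by move=> y x y0; apply: (is_derive_pt1 (f := G));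
      exact: Ck_on_is_derive CG (pt_left x y0).
  - by move=> y x y0; apply: (is_derive_pt1 (f := rderive G ^~ (pt 1 0)));
      exact: Ck_on_is_derive cGy (pt_left x y0).
  - by move=> y x y0; apply: (is_derive_pti (f := rderive G ^~ (pt 0 1)));
      exact: Ck_on_is_derive cGx (pt_left x y0).
  - move=> y y0; rewrite /rderive; congr (derive1 _ 0); apply/funext => t.
    rewrite !pt_rayi addr0 /G !mxE /cexp /expi /=.
    by rewrite -[2 * pi]/((2%:R : R) * pi) mulr_natl cosD2pi sinD2pi.
  - by move=> y x y0; exact: lap (pt_left x y0).
  - move=> y x y0 hx; rewrite gf//; apply: le_trans (ler_norm _) (hK _ _ _ hx).
    by rewrite in_itv/= expR_ge0 /= -expR0 ler_expR ltW.
have N01 : period_integral f 0 <= period_integral f 1.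
  apply: (@continuous_nondecreasing01 (period_integral f) cN) => a b a0 ab b1.
  have b0 := lt_trans a0 ab.
  have e c : 0 < c -> c < 1 -> period_integral f c = period_integral
    (fun y x => G (pt y x)) (ln c).
    move=> c0 c1; apply: eq_Rintegral => x _.
    by rewrite gf ?lnK// ln_lt0// c0 c1.
  rewrite (e a a0 (lt_trans ab b1)) (e b b0 b1); apply: mono;
    first by rewrite ltr_ln ?posrE.
  by rewrite ln_lt0// b0 b1.
have e0 : period_integral f 0 = 2 * pi * u z.
  transitivity (\int[mu]_(_ in `[0 : R, 2 * pi]%classic) u z).
    by apply: eq_Rintegral => x _;
      rewrite /f clamp_id ?lexx ?ler01// mul0r scale0r addr0.
  rewrite Rintegral_cst//= lebesgue_measure_itv/= lte_fin twopi_gt0 /= subr0.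
  by rewrite mulrC.
have k1 : clamp 1 = 1 by rewrite clamp_id // ler01 lexx.
have e1 : period_integral f 1 = \int[mu]_(x in `[0, 2 * pi]) u (z + expi x *: w).
  by apply: eq_Rintegral => x _; rewrite /f k1 mul1r.
move: N01; rewrite e0 e1 => h.
by rewrite ler_pdivlMl; [exact: h|exact: twopi_gt0].
Qed.

End SubMeanValue.

(** * The gap 1 - eta - |a - e^(i theta)|^2 and its Levi form *)

Section Gap.
Context {R : realType}.
Variables (H K : nat -> R -> R).
Hypothesis dH : forall n s, is_derive s (1 : R) (H n) (H n.+1 s).
Hypothesis dK : forall n s, is_derive s (1 : R) (K n) (K n.+1 s).

(** H 0 and K 0 stand for the two cutoffs, H n and K n for their derivatives;
    a1 + i a2 is the first coordinate. *)
Definition gap (a1 a2 t2 t3 : R) :=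
  2 * (a1 * cos (t2 + t3) + a2 * sin (t2 + t3)) - (a1 ^+ 2 + a2 ^+ 2)
  - H 0 (expR t2 + expR t3) - K 0 (expR (- t2) + expR (- t3)).

(** The differential of the gap, linear in (b1, b2, p, q). *)
Definition gap1 (a1 a2 t2 t3 b1 b2 p q : R) :=
  2 * (b1 * cos (t2 + t3) + b2 * sin (t2 + t3))
  + 2 * (p + q) * (a2 * cos (t2 + t3) - a1 * sin (t2 + t3))
  - 2 * (a1 * b1 + a2 * b2)
  - H 1 (expR t2 + expR t3) * (expR t2 * p + expR t3 * q)
  + K 1 (expR (- t2) + expR (- t3)) * (expR (- t2) * p + expR (- t3) * q).

(** The Hessian of the gap as a quadratic form in (b1, b2, p, q). *)
Definition gap2 (a1 a2 t2 t3 b1 b2 p q : R) :=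
  4 * (p + q) * (b2 * cos (t2 + t3) - b1 * sin (t2 + t3))
  - 2 * (p + q) ^+ 2 * (a1 * cos (t2 + t3) + a2 * sin (t2 + t3))
  - 2 * (b1 ^+ 2 + b2 ^+ 2)
  - H 2 (expR t2 + expR t3) * (expR t2 * p + expR t3 * q) ^+ 2
  - H 1 (expR t2 + expR t3) * (expR t2 * p ^+ 2 + expR t3 * q ^+ 2)
  - K 2 (expR (- t2) + expR (- t3)) * (expR (- t2) * p + expR (- t3) * q) ^+ 2
  - K 1 (expR (- t2) + expR (- t3)) * (expR (- t2) * p ^+ 2 + expR (- t3) * q ^+ 2).

Lemma is_derive_gap (a1 a2 t2 t3 : R -> R) (x b1 b2 p q : R) :
  is_derive x (1 : R) a1 b1 -> is_derive x (1 : R) a2 b2 ->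
  is_derive x (1 : R) t2 p -> is_derive x (1 : R) t3 q ->
  is_derive x (1 : R) (fun y => gap (a1 y) (a2 y) (t2 y) (t3 y))
    (gap1 (a1 x) (a2 x) (t2 x) (t3 x) b1 b2 p q).
Proof.
move=> d1 d2 d3 d4; rewrite /gap; apply: is_derive_eq.
rewrite /GRing.scale/= /gap1; ring.
Qed.

Lemma is_derive_gap1 (a1 a2 t2 t3 b1 b2 p q : R -> R) (x c1 c2 p' q' : R) :
  is_derive x (1 : R) a1 (b1 x) -> is_derive x (1 : R) a2 (b2 x) ->
  is_derive x (1 : R) t2 (p x) -> is_derive x (1 : R) t3 (q x) ->
  is_derive x (1 : R) b1 c1 -> is_derive x (1 : R) b2 c2 ->
  is_derive x (1 : R) p p' -> is_derive x (1 : R) q q' ->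
  is_derive x (1 : R)
    (fun y => gap1 (a1 y) (a2 y) (t2 y) (t3 y) (b1 y) (b2 y) (p y) (q y))
    (gap2 (a1 x) (a2 x) (t2 x) (t3 x) (b1 x) (b2 x) (p x) (q x) +
     gap1 (a1 x) (a2 x) (t2 x) (t3 x) c1 c2 p' q').
Proof.
move=> d1 d2 d3 d4 d5 d6 d7 d8; rewrite /gap1; apply: is_derive_eq.
rewrite /GRing.scale/= /gap2; ring.
Qed.

Lemma gap1D (a1 a2 t2 t3 b1 b2 p q b1' b2' p' q' : R) :
  gap1 a1 a2 t2 t3 b1 b2 p q + gap1 a1 a2 t2 t3 b1' b2' p' q' =
  gap1 a1 a2 t2 t3 (b1 + b1') (b2 + b2') (p + p') (q + q').
Proof. by rewrite /gap1; ring. Qed.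

Lemma gap10 (a1 a2 t2 t3 : R) : gap1 a1 a2 t2 t3 0 0 0 0 = 0.
Proof. by rewrite /gap1; ring. Qed.

(** e^(- lambda) Lap(e^lambda h(s)) for s = E2 + E3, where E_j = e^(t_j),
    grad t_2 = (p1, p2), grad t_3 = (q1, q2), grad lambda = (m1, m2), and t_2,
    t_3, lambda are harmonic. *)
Definition twisted_laplacian (h : nat -> R) (E2 E3 p1 p2 q1 q2 m1 m2 : R) :=
  h 2 * ((E2 * p1 + E3 * q1) ^+ 2 + (E2 * p2 + E3 * q2) ^+ 2)
  + h 1 * (E2 * (p1 ^+ 2 + p2 ^+ 2) + E3 * (q1 ^+ 2 + q2 ^+ 2))
  + 2 * h 1 * (m1 * (E2 * p1 + E3 * q1) + m2 * (E2 * p2 + E3 * q2))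
  + (m1 ^+ 2 + m2 ^+ 2) * h 0.

(** Lap(- log P) = (|grad P|^2 - P Lap P) / P^2 is nonnegative.  With
    grad a = ((b1, b2), (- b2, b1)) for the holomorphic first coordinate and
    grad lambda = (L1, L2) = (- theta_x, theta_y), the twisted Laplacian
    T = Lap P + 2 grad lambda . grad P + |grad lambda|^2 P is nonpositive, whence
    |grad P|^2 - P Lap P >= |grad P + P grad lambda|^2. *)
Lemma gap_levi_form (a1 a2 t2 t3 b1 b2 p1 p2 q1 q2 : R) :
  0 < gap a1 a2 t2 t3 ->
  0 <= twisted_laplacian (H ^~ (expR t2 + expR t3)) (expR t2) (expR t3)
         p1 p2 q1 q2 (- (p2 + q2)) (p1 + q1) ->
  0 <= twisted_laplacian (K ^~ (expR (- t2) + expR (- t3))) (expR (- t2))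
    (expR (- t3))
         (- p1) (- p2) (- q1) (- q2) (- (p2 + q2)) (p1 + q1) ->
  gap a1 a2 t2 t3 * (gap2 a1 a2 t2 t3 b1 b2 p1 q1 + gap2 a1 a2 t2 t3 (- b2) b1 p2 q2)
  <= gap1 a1 a2 t2 t3 b1 b2 p1 q1 ^+ 2 + gap1 a1 a2 t2 t3 (- b2) b1 p2 q2 ^+ 2.
Proof.
set P := gap _ _ _ _ => P0 TH TK.
set G1 := gap1 _ _ _ _ b1 _ _ _; set G2 := gap1 _ _ _ _ (- b2) _ _ _.
set L1 := - (p2 + q2); set L2 := p1 + q1.
have T : gap2 a1 a2 t2 t3 b1 b2 p1 q1 + gap2 a1 a2 t2 t3 (- b2) b1 p2 q2
    + 2 * (L1 * G1 + L2 * G2) + (L1 ^+ 2 + L2 ^+ 2) * P <= 0.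
  (* the contribution of e^lambda |a|^2; that of 2 Re(a e^(- i theta)) is 0 *)
  have sq : 0 <= (2 * b1 + L1 * a1 + L2 * a2) ^+ 2 + (2 * b2 + L1 * a2 - L2 * a1) ^+
    2.
    by rewrite addr_ge0 ?sqr_ge0.
  have := addr_ge0 sq (addr_ge0 TH TK); rewrite -oppr_le0.
  apply: le_trans; rewrite le_eqVlt; apply/orP; left; apply/eqP.
  rewrite /P /G1 /G2 /gap /gap1 /gap2 /twisted_laplacian /L1 /L2; ring.
have := mulr_ge0_le0 (ltW P0) T.
have := sqr_ge0 (G1 + P * L1); have := sqr_ge0 (G2 + P * L2).
lra.
Qed.

End Gap.

Section CutoffTwisted.
Context {R : realType}.

(** With x = s - B^2 and g = c / x^2, the cutoff h satisfies h' = g h and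
    h'' = (g^2 - 2 g / x) h.  Half of g^2 |grad s|^2 absorbs the mixed term up to
    - |grad lambda|^2, the other half absorbs - (2 g / x) |grad s|^2 as soon as
    c >= 4 x, and g Lap s >= g m (|grad t_2|^2 + |grad t_3|^2) absorbs the
    remaining |grad lambda|^2. *)
Lemma cutoff_twisted_laplacian_ge0 (A B c m E2 E3 p1 p2 q1 q2 m1 m2 : R) :
  0 < m -> m <= E2 -> m <= E3 -> E2 + E3 < A ^+ 2 ->
  0 < c -> 4 * A ^+ 2 <= c -> 2 * A ^+ 4 <= c * m ->
  m1 ^+ 2 + m2 ^+ 2 = (p1 + q1) ^+ 2 + (p2 + q2) ^+ 2 ->
  0 <= twisted_laplacian (cutoffD A B c ^~ (E2 + E3)) E2 E3 p1 p2 q1 q2 m1 m2.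
Proof.
move=> m0 mE2 mE3 sA c0 cA cm hm; rewrite /twisted_laplacian.
case: (leP (E2 + E3) (B ^+ 2)) => hs.
  by rewrite !cutoffD_le// !(mul0r, mulr0, addr0).
rewrite cutoffD0 cutoffD1// cutoffD2//.
set s1 := E2 * p1 + E3 * q1; set s2 := E2 * p2 + E3 * q2.
set x := E2 + E3 - B ^+ 2; set h := cutoff _ _ _ _.
have x0 : 0 < x by rewrite /x subr_gt0.
have xA : x < A ^+ 2 by have := sqr_ge0 B; rewrite /x; lra.
set Q := E2 * _ + E3 * _; set L := m1 ^+ 2 + m2 ^+ 2.
pose g := c / x ^+ 2.
have g0 : 0 < g by rewrite divr_gt0// exprn_gt0.
have xn0 : x != 0 by rewrite gt_eqF.
have -> : (c ^+ 2 / x ^+ 4 - 2 * c / x ^+ 3) * h * (s1 ^+ 2 + s2 ^+ 2)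
  + c / x ^+ 2 * h * Q + 2 * (c / x ^+ 2 * h) * (m1 * s1 + m2 * s2) + L * h =
  h * (((g * s1 + 2 * m1) ^+ 2 + (g * s2 + 2 * m2) ^+ 2) / 2
       + (g / 2 - 2 / x) * g * (s1 ^+ 2 + s2 ^+ 2) + (g * Q - L)).
  by rewrite /g /L; field.
apply: mulr_ge0; [exact: cutoff_ge0|apply: addr_ge0; [apply: addr_ge0|]].
- by rewrite divr_ge0// addr_ge0 ?sqr_ge0.
- rewrite mulr_ge0 ?addr_ge0 ?sqr_ge0// mulr_ge0 ?(ltW g0)//.
  rewrite /g (_ : _ - _ = (c - 4 * x) / (2 * x ^+ 2)); last by field.
  by rewrite divr_ge0 ?mulr_ge0 ?sqr_ge0//; lra.
- rewrite subr_ge0 /L hm.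
  have gm : 2 <= g * m.
    rewrite /g mulrAC ler_pdivlMr ?exprn_gt0//; apply: le_trans cm.
    by rewrite ler_pM2l// -[4%N]/(2 * 2)%N exprM ler_sqr ?nnegrE ?sqr_ge0 ?(ltW xA)
      ?(ltW x0).
  apply: (@le_trans _ _ (g * m * (p1 ^+ 2 + p2 ^+ 2 + (q1 ^+ 2 + q2 ^+ 2)))).
    apply: (@le_trans _ _ (2 * (p1 ^+ 2 + p2 ^+ 2 + (q1 ^+ 2 + q2 ^+ 2)))).
      by have := sqr_ge0 (p1 - q1); have := sqr_ge0 (p2 - q2); lra.
    by rewrite ler_wpM2r// !addr_ge0 ?sqr_ge0.
  rewrite -mulrA ler_pM2l// mulrDr lerD// ler_wpM2r// addr_ge0 ?sqr_ge0//.
Qed.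
End CutoffTwisted.

(** * Smoothness of the gap in the complex coordinates *)

Section SmoothFamilies.
Context {R : realType}.

(** Shifts by pi / 2 give the derivatives of sine and cosine without cases. *)
Definition cos_family (n : nat) (x : R) := cos (x + (pi / 2) *+ n).
Definition sin_family (n : nat) (x : R) := sin (x + (pi / 2) *+ n).
Definition ln_family (n : nat) (x : R) :=
  if n is m.+1 then (-1) ^+ m * m`!%:R * x^-1 ^+ m.+1 else ln x.

Lemma is_derive_cos_family n x :
  is_derive x (1 : R) (cos_family n) (cos_family n.+1 x).
Proof.
rewrite /cos_family [_ *+ n.+1]mulrSr addrA cosDpihalf.
by apply: is_derive_eq; rewrite /GRing.scale/= addr0 mulr1.
Qed.

Lemma is_derive_sin_family n x :
  is_derive x (1 : R) (sin_family n) (sin_family n.+1 x).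
Proof.
rewrite /sin_family [_ *+ n.+1]mulrSr addrA sinDpihalf.
by apply: is_derive_eq; rewrite /GRing.scale/= addr0 mulr1.
Qed.

Lemma is_derive_ln_family n (x : R) :
  0 < x -> is_derive x (1 : R) (ln_family n) (ln_family n.+1 x).
Proof.
move=> x0; have xn0 : x != 0 by rewrite gt_eqF.
case: n => [|n].
  rewrite /ln_family expr0 fact0 !mul1r expr1; exact: is_derive1_ln.
have dV : is_derive x (1 : R) (fun y : R => y^-1) (- x ^- 2).
  by have := is_deriveV xn0 (is_derive_id x (1 : R)); rewrite /GRing.scale/= mulr1.
have dX : is_derive x (1 : R) (fun y : R => y^-1 ^+ n.+1)
  (n.+1%:R * x^-1 ^+ n * (- x ^- 2)).
  by have := is_deriveX n.+1 dV; rewrite exprfctE.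
rewrite /ln_family; apply: is_derive_eq.
by rewrite /GRing.scale/= factS natrM -[x ^- 2]exprVn !exprS; ring.
Qed.

End SmoothFamilies.

Section SmoothGap.
Context {R : realType} {n : nat}.
Local Notation Cn := 'rV[R[i]]_n.
Implicit Types (U : set Cn) (f g : Cn -> R) (k : nat).

Lemma Ck_on_opp k U f : open U -> Ck_on k U f -> Ck_on k U (fun z => - f z).
Proof.
move=> oU Cf; apply: (eq_Ck_on (f := fun z => (-1) * f z)) => //.
  by move=> z _; rewrite mulN1r.
by apply: Ck_on_mul => //; exact: Ck_on_cst.
Qed.

Lemma Ck_on_sqr k U f : open U -> Ck_on k U f -> Ck_on k U (fun z => f z ^+ 2).
Proof. by move=> oU Cf; apply: Ck_on_mul. Qed.

Lemma Ck_on_cos k U f : open U -> Ck_on k U f -> Ck_on k U (fun z => cos (f z)).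
Proof.
move=> oU Cf; apply: (eq_Ck_on (f := fun z => cos_family 0 (f z))) => //.
  by move=> z _; rewrite /cos_family addr0.
by apply: (Ck_on_comp (V := setT)) => // m x _; exact: is_derive_cos_family.
Qed.

Lemma Ck_on_sin k U f : open U -> Ck_on k U f -> Ck_on k U (fun z => sin (f z)).
Proof.
move=> oU Cf; apply: (eq_Ck_on (f := fun z => sin_family 0 (f z))) => //.
  by move=> z _; rewrite /sin_family addr0.
by apply: (Ck_on_comp (V := setT)) => // m x _; exact: is_derive_sin_family.
Qed.

Lemma Ck_on_expR k U f : open U -> Ck_on k U f -> Ck_on k U (fun z => expR (f z)).
Proof.
move=> oU Cf; apply: (Ck_on_comp (V := setT) (phi := fun=> expR) _ _ _ _ 0%N) =>
  // m x _.
Qed.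

Lemma Ck_on_ln k U f : open U -> (forall z, U z -> 0 < f z) -> Ck_on k U f ->
  Ck_on k U (fun z => ln (f z)).
Proof.
move=> oU f0 Cf; apply: (Ck_on_comp (V := [set x : R | 0 < x]) (phi := ln_family) _ _
  _ _ 0%N) => // m x.
exact: is_derive_ln_family.
Qed.

Lemma Ck_on_gap (H K : nat -> R -> R) k U f1 f2 f3 f4 :
  (forall n s, is_derive s (1 : R) (H n) (H n.+1 s)) ->
  (forall n s, is_derive s (1 : R) (K n) (K n.+1 s)) -> open U ->
  Ck_on k U f1 -> Ck_on k U f2 -> Ck_on k U f3 -> Ck_on k U f4 ->
  Ck_on k U (fun z => gap H K (f1 z) (f2 z) (f3 z) (f4 z)).
Proof.
move=> dH dK oU C1 C2 C3 C4; rewrite /gap.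
have CH f : Ck_on k U f -> Ck_on k U (fun z => H 0%N (f z)).
  by move=> Cf; apply: (Ck_on_comp (V := setT) (phi := H)) => // m x _.
have CK f : Ck_on k U f -> Ck_on k U (fun z => K 0%N (f z)).
  by move=> Cf; apply: (Ck_on_comp (V := setT) (phi := K)) => // m x _.
repeat first [assumption | apply: Ck_on_cst =>
  // | apply: CH | apply: CK | apply: Ck_on_opp => // | apply: Ck_on_add => //
  | apply: Ck_on_cos => // | apply: Ck_on_sin => // | apply: Ck_on_expR =>
    // | apply: Ck_on_sqr => // | apply: Ck_on_mul => //].
Qed.

End SmoothGap.

Section WormGap.
Context {R : realType}.
Local Notation C := (R[i]).
Variables (Ap Bp cp Am Bm cm : R).

Definition logsq (w : C) : R := ln (cmod w ^+ 2).

Definition worm_gap (z : 'rV[C]_3) : R :=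
  gap (cutoffD Ap Bp cp) (cutoffD Am Bm cm)
    (complex.Re (z 0 0)) (complex.Im (z 0 0)) (logsq (z 0 1)) (logsq (z 0 2)).

Lemma cmod_sqr (w : C) : cmod w ^+ 2 = complex.Re w ^+ 2 + complex.Im w ^+ 2.
Proof. by case: w => a b /=; rewrite sqr_sqrtr// addr_ge0 ?sqr_ge0. Qed.

Lemma cmod_sqr_gt0 (w : C) : w != 0 -> 0 < cmod w ^+ 2.
Proof. by move=> w0; rewrite exprn_gt0// cmod_gt0. Qed.

Lemma logsqM (v w : C) : v != 0 -> w != 0 -> logsq (v * w) = logsq v + logsq w.
Proof.
move=> v0 w0; rewrite /logsq ComplexField.Normc.normcM exprMn lnM//; rewrite posrE;
  exact: cmod_sqr_gt0.
Qed.

Lemma worm_gapE (z : 'rV[C]_3) : z 0 1 != 0 -> z 0 2 != 0 ->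
  worm_gap z = 1 - worm_eta Ap Bp cp Am Bm cm (logsq (z 0 1)) (logsq (z 0 2))
    - cmod (z 0 0 - expi (logsq (z 0 1 * z 0 2))) ^+ 2.
Proof.
move=> z1 z2; rewrite logsqM// cmod_sqr /worm_gap /gap /worm_eta !cutoffD0.
case: (z 0 0) => a b; rewrite /expi; simpc => /=.
set th := logsq (z 0 1) + logsq (z 0 2); have := cos2Dsin2 th; set c :=
  cos th; set s := sin th.
set e := cutoff _ _ _ _; set e' := cutoff _ _ _ _.
by move=> cs; rewrite -[in RHS]cs; ring.
Qed.

Lemma wormE : worm (worm_eta Ap Bp cp Am Bm cm) =
  [set z : 'rV[C]_3 | [/\ z 0 1 != 0, z 0 2 != 0 & 0 < worm_gap z]].
Proof.
apply/seteqP; split => z /= [z1 z2 h]; split=> //.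
  by rewrite worm_gapE// subr_gt0.
by rewrite worm_gapE// subr_gt0 in h.
Qed.

Definition off_axes : set 'rV[C]_3 := [set z : 'rV[C]_3 | z 0 1 != 0 /\ z 0 2 != 0].

Lemma neq0_sqr_gt0 (w : C) : w != 0 -> 0 < complex.Re w ^+ 2 + complex.Im w ^+ 2.
Proof. by rewrite -cmod_sqr; exact: cmod_sqr_gt0. Qed.

Lemma cmod_sqr_coord_continuous {n} (j : 'I_n) :
  continuous (fun z : 'rV[C]_n => cmod (z 0 j) ^+ 2).
Proof.
have oT : open [set: 'rV[C]_n] by exact: openT.
have -> : (fun z : 'rV[C]_n => cmod (z 0 j) ^+ 2) =
    (fun z => complex.Re (z 0 j) ^+ 2 + complex.Im (z 0 j) ^+ 2).
  by apply/funext => z; rewrite cmod_sqr.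
have CN := Ck_on_add oT (Ck_on_sqr oT (@Ck_on_Re R n 0 _ j oT))
  (Ck_on_sqr oT (@Ck_on_Im R n 0 _ j oT)).
by move=> z; exact: (Ck_on_continuous CN).
Qed.

Lemma open_off_axes : open off_axes.
Proof.
have oj (j : 'I_3) : open [set z : 'rV[C]_3 | z 0 j != 0].
  rewrite (_ : [set z | _] = (fun z : 'rV[C]_3 => cmod (z 0 j) ^+ 2) @^-1`
    [set x | 0 < x]).
    by apply: open_comp => [z _|]; [exact: cmod_sqr_coord_continuous|exact: open_gt].
  apply/seteqP; split => z /=; first exact: cmod_sqr_gt0.
  by apply: contraTneq => ->; rewrite ComplexField.Normc.normc0 expr0n ltxx.
rewrite (_ : off_axes = [set z : 'rV[C]_3 | z 0 1 != 0] `&`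
  [set z : 'rV[C]_3 | z 0 2 != 0])//.
exact: openI.
Qed.

Lemma Ck_on_logsq {n} k (U : set 'rV[C]_n) (f : 'rV[C]_n -> C) : open U ->
  (forall z, U z -> f z != 0) ->
  Ck_on k U (fun z => complex.Re (f z)) -> Ck_on k U (fun z => complex.Im (f z)) ->
  Ck_on k U (fun z => logsq (f z)).
Proof.
move=> oU f0 Cr Ci.
apply: (eq_Ck_on (f := fun z => ln (complex.Re (f z) ^+ 2 + complex.Im (f z) ^+ 2)))
  => //.
  by move=> z _; rewrite /logsq cmod_sqr.
apply: Ck_on_ln => //; first by move=> z Uz; rewrite -cmod_sqr cmod_sqr_gt0// f0.
by apply: Ck_on_add => //; apply: Ck_on_sqr.
Qed.

Hypothesis cp0 : 0 < cp.
Hypothesis cm0 : 0 < cm.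

Lemma Ck_on_worm_gap {n} k (U : set 'rV[C]_n) (phi : 'rV[C]_n -> 'rV[C]_3) : open U ->
  (forall z, U z -> off_axes (phi z)) ->
  (forall j, Ck_on k U (fun z => complex.Re (phi z 0 j))) ->
  (forall j, Ck_on k U (fun z => complex.Im (phi z 0 j))) ->
  Ck_on k U (fun z => worm_gap (phi z)).
Proof.
move=> oU phi0 Cr Ci; apply: Ck_on_gap => //.
- by move=> m s; exact: is_derive_cutoffD.
- by move=> m s; exact: is_derive_cutoffD.
- by apply: Ck_on_logsq => // z Uz; have [] := phi0 z Uz.
- by apply: Ck_on_logsq => // z Uz; have [] := phi0 z Uz.
Qed.

Lemma smooth_worm_gap : smooth_on off_axes worm_gap.
Proof.
move=> k; apply: (Ck_on_worm_gap (phi := id)) => //; first exact: open_off_axes.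
- by move=> j; apply: Ck_on_Re; exact: open_off_axes.
- by move=> j; apply: Ck_on_Im; exact: open_off_axes.
Qed.

Lemma worm_gap_continuous z : off_axes z -> {for z, continuous worm_gap}.
Proof. by move=> h; exact: (Ck_on_continuous (smooth_worm_gap 0) h). Qed.

Lemma open_worm : open (worm (worm_eta Ap Bp cp Am Bm cm)).
Proof.
rewrite wormE openE => z /= [z1 z2 g0].
have oz : off_axes z by [].
have h1 : nbhs z off_axes by apply: open_nbhs_nbhs; split=> //; exact: open_off_axes.
have h2 : nbhs z (worm_gap @^-1` [set x | 0 < x]).
  by apply: (worm_gap_continuous oz); apply: open_nbhs_nbhs; split=> //;
    exact: open_gt.
by apply: filterS2 h1 h2 => y [y1 y2] gy; split.
Qed.

End WormGap.

(** * A complex line in the exponential coordinate *)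

Section ExponentialDisc.
Context {R : realType}.
Local Notation C := (R[i]).
Local Notation C1 := 'rV[C]_1.
Implicit Types (z w : C) (zeta : C1).

(** The parts of the velocity w e^zeta and of the point z + w e^zeta of a complex
    line; the velocity is the derivative in zeta both of the point and of itself. *)
Definition vre w zeta := complex.Re (cexp (zeta 0 0) * w).
Definition vim w zeta := complex.Im (cexp (zeta 0 0) * w).
Definition cre z w zeta := complex.Re (z + cexp (zeta 0 0) * w).
Definition cim z w zeta := complex.Im (z + cexp (zeta 0 0) * w).

Lemma vreE w y x : vre w (pt y x) = expR y *
  (cos x * complex.Re w - sin x * complex.Im w).
Proof. by rewrite /vre mxE /cexp -mulrA Re_realM /=; case: w => a b; rewrite /expi;
  simpc. Qed.

Lemma vimE w y x : vim w (pt y x) = expR y *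
  (cos x * complex.Im w + sin x * complex.Re w).
Proof. by rewrite /vim mxE /cexp -mulrA Im_realM /=; case: w => a b; rewrite /expi;
  simpc. Qed.

Lemma creE z w zeta : cre z w zeta = complex.Re z + vre w zeta.
Proof. by rewrite /cre raddfD. Qed.

Lemma cimE z w zeta : cim z w zeta = complex.Im z + vim w zeta.
Proof. by rewrite /cim raddfD. Qed.

Lemma ptE zeta : zeta = pt (complex.Re (zeta 0 0)) (complex.Im (zeta 0 0)).
Proof. by apply/rowP => j; rewrite ord1 mxE; case: (zeta 0 0). Qed.

Local Notation e1 := (pt (1 : R) 0).
Local Notation ei := (pt (0 : R) 1).

Lemma ray_pt1 (f : C1 -> R) y x : ray (pt y x) e1 f = fun t => f (pt (t + y) x).
Proof. by apply/funext => t; rewrite /ray pt_ray1. Qed.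

Lemma ray_pti (f : C1 -> R) y x : ray (pt y x) ei f = fun t => f (pt y (t + x)).
Proof. by apply/funext => t; rewrite /ray pt_rayi. Qed.

Lemma is_derive_vre1 w zeta : is_derive (0 : R) (1 : R) (ray zeta e1 (vre w))
  (vre w zeta).
Proof.
rewrite (ptE zeta); set y := complex.Re _; set x := complex.Im _.
rewrite ray_pt1; under eq_fun do rewrite vreE.
by apply: is_derive_eq; rewrite /GRing.scale/= vreE add0r; ring.
Qed.

Lemma is_derive_vim1 w zeta : is_derive (0 : R) (1 : R) (ray zeta e1 (vim w))
  (vim w zeta).
Proof.
rewrite (ptE zeta); set y := complex.Re _; set x := complex.Im _.
rewrite ray_pt1; under eq_fun do rewrite vimE.
by apply: is_derive_eq; rewrite /GRing.scale/= vimE add0r; ring.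
Qed.

Lemma is_derive_vrei w zeta : is_derive (0 : R) (1 : R) (ray zeta ei (vre w))
  (- vim w zeta).
Proof.
rewrite (ptE zeta); set y := complex.Re _; set x := complex.Im _.
rewrite ray_pti; under eq_fun do rewrite vreE.
by apply: is_derive_eq; rewrite /GRing.scale/= vimE add0r; ring.
Qed.

Lemma is_derive_vimi w zeta : is_derive (0 : R) (1 : R) (ray zeta ei (vim w))
  (vre w zeta).
Proof.
rewrite (ptE zeta); set y := complex.Re _; set x := complex.Im _.
rewrite ray_pti; under eq_fun do rewrite vimE.
by apply: is_derive_eq; rewrite /GRing.scale/= vreE add0r; ring.
Qed.

Lemma is_derive_addcst (f : R -> R) (c d x : R) : is_derive x (1 : R) f d ->
  is_derive x (1 : R) (fun t => c + f t) d.
Proof. by move=> df; have := is_deriveD (is_derive_cst c x (1 : R)) df;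
  rewrite add0r. Qed.

Lemma ray_cre z w zeta v : ray zeta v (cre z w) = fun t =>
  complex.Re z + ray zeta v (vre w) t.
Proof. by apply/funext => t; rewrite /ray creE. Qed.

Lemma ray_cim z w zeta v : ray zeta v (cim z w) = fun t =>
  complex.Im z + ray zeta v (vim w) t.
Proof. by apply/funext => t; rewrite /ray cimE. Qed.

Lemma is_derive_cre1 z w zeta :
  is_derive (0 : R) (1 : R) (ray zeta e1 (cre z w)) (vre w zeta).
Proof. by rewrite ray_cre; apply: is_derive_addcst; exact: is_derive_vre1. Qed.

Lemma is_derive_cim1 z w zeta :
  is_derive (0 : R) (1 : R) (ray zeta e1 (cim z w)) (vim w zeta).
Proof. by rewrite ray_cim; apply: is_derive_addcst; exact: is_derive_vim1. Qed.

Lemma is_derive_crei z w zeta :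
  is_derive (0 : R) (1 : R) (ray zeta ei (cre z w)) (- vim w zeta).
Proof. by rewrite ray_cre; apply: is_derive_addcst; exact: is_derive_vrei. Qed.

Lemma is_derive_cimi z w zeta :
  is_derive (0 : R) (1 : R) (ray zeta ei (cim z w)) (vre w zeta).
Proof. by rewrite ray_cim; apply: is_derive_addcst; exact: is_derive_vimi. Qed.

Lemma Ck_on_vre k U w : open U -> Ck_on k U (vre w).
Proof.
move=> oU; apply: (eq_Ck_on (f := fun zeta => expR (complex.Re (zeta 0 0)) *
  (cos (complex.Im (zeta 0 0)) * complex.Re w + -
    (sin (complex.Im (zeta 0 0)) * complex.Im w)))) => //.
  by move=> zeta _; rewrite [in RHS](ptE zeta) vreE.
have Cr := @Ck_on_Re R 1 k U 0 oU; have Ci := @Ck_on_Im R 1 k U 0 oU.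
apply: Ck_on_mul => //; first exact: Ck_on_expR.
apply: Ck_on_add => //; [|apply: Ck_on_opp => //]; apply: Ck_on_mul => //;
  try exact: Ck_on_cst; [exact: Ck_on_cos|exact: Ck_on_sin].
Qed.

Lemma Ck_on_vim k U w : open U -> Ck_on k U (vim w).
Proof.
move=> oU; apply: (eq_Ck_on (f := fun zeta => expR (complex.Re (zeta 0 0)) *
  (cos (complex.Im (zeta 0 0)) * complex.Im w + sin (complex.Im (zeta 0 0)) *
    complex.Re w))) => //.
  by move=> zeta _; rewrite [in RHS](ptE zeta) vimE.
have Cr := @Ck_on_Re R 1 k U 0 oU; have Ci := @Ck_on_Im R 1 k U 0 oU.
apply: Ck_on_mul => //; first exact: Ck_on_expR.
apply: Ck_on_add => //; apply: Ck_on_mul => //;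
  try exact: Ck_on_cst; [exact: Ck_on_cos|exact: Ck_on_sin].
Qed.

Lemma Ck_on_cre k U z w : open U -> Ck_on k U (cre z w).
Proof.
move=> oU; apply: (eq_Ck_on (f := fun zeta => complex.Re z + vre w zeta)) => //.
  by move=> zeta _; rewrite creE.
by apply: Ck_on_add => //; [exact: Ck_on_cst|exact: Ck_on_vre].
Qed.

Lemma Ck_on_cim k U z w : open U -> Ck_on k U (cim z w).
Proof.
move=> oU; apply: (eq_Ck_on (f := fun zeta => complex.Im z + vim w zeta)) => //.
  by move=> zeta _; rewrite cimE.
by apply: Ck_on_add => //; [exact: Ck_on_cst|exact: Ck_on_vim].
Qed.

(** log|z + w e^zeta|^2, its first derivatives in the directions 1 and i, and its
    second derivative in the direction 1; harmonicity says that the second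
    derivative in the direction i is the opposite of the last one. *)
Definition nsq z w zeta := cre z w zeta ^+ 2 + cim z w zeta ^+ 2.
Definition lsq z w zeta := ln (nsq z w zeta).
Definition d1_lsq z w zeta := 2 *
  (cre z w zeta * vre w zeta + cim z w zeta * vim w zeta) / nsq z w zeta.
Definition di_lsq z w zeta := 2 *
  (vre w zeta * cim z w zeta - vim w zeta * cre z w zeta) / nsq z w zeta.
Definition d11_lsq z w zeta :=
  2 * (cre z w zeta * vre w zeta + cim z w zeta * vim w zeta + vre w zeta ^+ 2 + vim
    w zeta ^+ 2) / nsq z w zeta
  - d1_lsq z w zeta ^+ 2.

Lemma is_derive_lsq (f g : R -> R) (x df dg : R) : 0 < f x ^+ 2 + g x ^+ 2 ->
  is_derive x (1 : R) f df -> is_derive x (1 : R) g dg ->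
  is_derive x (1 : R) (fun t => ln (f t ^+ 2 + g t ^+ 2))
    (2 * (f x * df + g x * dg) / (f x ^+ 2 + g x ^+ 2)).
Proof.
move=> fg0 d1 d2.
have dN : is_derive x (1 : R) (fun t => f t ^+ 2 + g t ^+ 2)
  (2 * (f x * df + g x * dg)).
  by apply: is_derive_eq; rewrite /GRing.scale/=; ring.
have := @is_derive1_comp R (@ln R) (fun t => f t ^+ 2 + g t ^+ 2) x _ _
  (is_derive1_ln fg0) dN.
by rewrite mulrC.
Qed.

Lemma is_derive_divf (f g : R -> R) (x df dg : R) : g x != 0 ->
  is_derive x (1 : R) f df -> is_derive x (1 : R) g dg ->
  is_derive x (1 : R) (fun t => f t / g t) (df / g x - f x * dg / g x ^+ 2).
Proof.
move=> g0 d1 d2; have dV := is_deriveV g0 d2.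
have H := is_deriveM d1 dV; apply: (is_derive_eq H).
by rewrite /GRing.scale/=; field.
Qed.

Lemma is_derive_lsq1 z w zeta : 0 < nsq z w zeta ->
  is_derive (0 : R) (1 : R) (ray zeta e1 (lsq z w)) (d1_lsq z w zeta).
Proof.
move=> n0; have d1 := is_derive_cre1 z w zeta; have d2 := is_derive_cim1 z w zeta.
have := @is_derive_lsq (ray zeta e1 (cre z w)) (ray zeta e1 (cim z w)) 0 _ _ _ d1 d2.
by rewrite !rayE0 => /(_ n0).
Qed.

Lemma is_derive_lsqi z w zeta : 0 < nsq z w zeta ->
  is_derive (0 : R) (1 : R) (ray zeta ei (lsq z w)) (di_lsq z w zeta).
Proof.
move=> n0; have d1 := is_derive_crei z w zeta; have d2 := is_derive_cimi z w zeta.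
have := @is_derive_lsq (ray zeta ei (cre z w)) (ray zeta ei (cim z w)) 0 _ _ _ d1 d2.
rewrite !rayE0 => /(_ n0); move/is_derive_eq; apply.
by rewrite /di_lsq /nsq; congr (2 * _ / _); ring.
Qed.

Lemma is_derive_lsq11 z w zeta : 0 < nsq z w zeta ->
  is_derive (0 : R) (1 : R) (ray zeta e1 (d1_lsq z w)) (d11_lsq z w zeta).
Proof.
move=> n0; have d1 := is_derive_cre1 z w zeta; have d2 := is_derive_cim1 z w zeta.
have d3 := is_derive_vre1 w zeta; have d4 := is_derive_vim1 w zeta.
have nn0 : nsq z w zeta != 0 by rewrite gt_eqF.
have dN : is_derive (0 : R) (1 : R) (ray zeta e1 (nsq z w))
    (2 * (cre z w zeta * vre w zeta + cim z w zeta * vim w zeta)).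
  have -> : ray zeta e1 (nsq z w) =
    (fun t => ray zeta e1 (cre z w) t ^+ 2 + ray zeta e1 (cim z w) t ^+ 2) by [].

  by apply: is_derive_eq; rewrite /GRing.scale/= !rayE0; ring.
pose g t := 2 * (ray zeta e1 (cre z w) t * ray zeta e1 (vre w) t + ray zeta e1
  (cim z w) t * ray zeta e1 (vim w) t).
have dg : is_derive (0 : R) (1 : R) g
    (2 * (cre z w zeta * vre w zeta + cim z w zeta * vim w zeta + vre w zeta ^+ 2 +
      vim w zeta ^+ 2)).
  by rewrite /g; apply: is_derive_eq; rewrite /GRing.scale/= !rayE0; ring.
have := @is_derive_divf g (ray zeta e1 (nsq z w)) 0 _ _ _ dg dN.
rewrite rayE0 => /(_ nn0); move/is_derive_eq; apply.
by rewrite /g !rayE0 /d11_lsq /d1_lsq; field.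
Qed.

Lemma is_derive_lsqii z w zeta : 0 < nsq z w zeta ->
  is_derive (0 : R) (1 : R) (ray zeta ei (di_lsq z w)) (- d11_lsq z w zeta).
Proof.
move=> n0; have d1 := is_derive_crei z w zeta; have d2 := is_derive_cimi z w zeta.
have d3 := is_derive_vrei w zeta; have d4 := is_derive_vimi w zeta.
have nn0 : nsq z w zeta != 0 by rewrite gt_eqF.
have dN : is_derive (0 : R) (1 : R) (ray zeta ei (nsq z w))
    (2 * (vre w zeta * cim z w zeta - vim w zeta * cre z w zeta)).
  have -> : ray zeta ei (nsq z w) =
    (fun t => ray zeta ei (cre z w) t ^+ 2 + ray zeta ei (cim z w) t ^+ 2) by [].

  by apply: is_derive_eq; rewrite /GRing.scale/= !rayE0; ring.
pose g t := 2 * (ray zeta ei (vre w) t * ray zeta ei (cim z w) t - ray zeta ei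
  (vim w) t * ray zeta ei (cre z w) t).
have dg : is_derive (0 : R) (1 : R) g
    (2 * (- vim w zeta * cim z w zeta + vre w zeta ^+ 2 - vre w zeta * cre z w zeta +
      vim w zeta ^+ 2)).
  by rewrite /g; apply: is_derive_eq; rewrite /GRing.scale/= !rayE0; ring.
have := @is_derive_divf g (ray zeta ei (nsq z w)) 0 _ _ _ dg dN.
rewrite rayE0 => /(_ nn0); move/is_derive_eq; apply.
rewrite /g !rayE0 /d11_lsq /d1_lsq; move: nn0; rewrite /nsq.
move: (cre z w zeta) (cim z w zeta) (vre w zeta) (vim w zeta) => a b a' b' nn0.
by field.
Qed.

End ExponentialDisc.

(** * Pseudoconvexity *)

Section SecondDerivative.
Context {R : realType} {n : nat}.

Lemma second_rderive (G D : 'rV[R[i]]_n -> R) (U : set 'rV[R[i]]_n) v z (d : R) :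
  open U ->
  (forall p, U p -> is_derive (0 : R) (1 : R) (ray p v G) (D p)) -> U z ->
  is_derive (0 : R) (1 : R) (ray z v D) d ->
  rderive (rderive G ^~ v) z v = d.
Proof.
move=> oU dG Uz dD.
have eD : {in U, D =1 rderive G ^~ v}.
  by move=> p; rewrite inE => Up; have [_ ->] := rderive_def (dG p Up).
have [h1 h2] := rderive_def dD.
by have [_ ->] := eq_rderive oU eD Uz h1.
Qed.

Lemma is_derive_oppln (f : R -> R) (x d : R) : 0 < f x -> is_derive x (1 : R) f d ->
  is_derive x (1 : R) (fun t => - ln (f t)) (- (d / f x)).
Proof.
move=> f0 df.
have H := is_deriveN (@is_derive1_comp R (@ln R) f x _ _ (is_derive1_ln f0) df).
by apply: (is_derive_eq H); rewrite mulrC.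
Qed.

End SecondDerivative.

Section WormPseudoconvex.
Context {R : realType}.
Local Notation C := (R[i]).
Variables (Ap Bp cp Am Bm cm : R).
Hypothesis BAp : 0 < Bp < Ap.
Hypothesis BAm : 0 < Bm < Am.
Hypothesis cp0 : 0 < cp.
Hypothesis cm0 : 0 < cm.

Local Notation W := (worm (worm_eta Ap Bp cp Am Bm cm)).
Local Notation gap_ := (worm_gap Ap Bp cp Am Bm cm).
Local Notation H := (cutoffD Ap Bp cp).
Local Notation K := (cutoffD Am Bm cm).

Lemma worm_eta_lt1 (z : 'rV[C]_3) : W z ->
  worm_eta Ap Bp cp Am Bm cm (logsq (z 0 1)) (logsq (z 0 2)) < 1.
Proof.
by move=> [_ _ h]; rewrite -subr_gt0; apply: le_lt_trans h; rewrite sqr_ge0.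
Qed.

Lemma worm_eta_bounds (t2 t3 : R) : worm_eta Ap Bp cp Am Bm cm t2 t3 < 1 ->
  expR t2 + expR t3 < Ap ^+ 2 /\ expR (- t2) + expR (- t3) < Am ^+ 2.
Proof.
rewrite /worm_eta => h; split.
  apply: (cutoff_lt1 cp0 BAp); apply: le_lt_trans h.
  by rewrite lerDl cutoff_ge0.
apply: (cutoff_lt1 cm0 BAm); apply: le_lt_trans h.
by rewrite lerDr cutoff_ge0.
Qed.

Lemma expR_ge_inv (A t : R) : 0 < A -> expR (- t) < A ^+ 2 -> A ^- 2 <= expR t.
Proof.
move=> A0 ht; rewrite -[expR t]invrK -expRN.
by rewrite lef_pV2 ?posrE ?invr_gt0 ?expR_gt0 ?exprn_gt0 ?(ltW ht).
Qed.

Lemma expR_logsq (w : C) : w != 0 -> expR (logsq w) = cmod w ^+ 2.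
Proof. by move=> w0; rewrite /logsq lnK// posrE cmod_sqr_gt0. Qed.

Lemma cmod_ge0 (w : C) : 0 <= cmod w.
Proof. by case: w => a b; rewrite sqrtr_ge0. Qed.

Lemma Re_le_cmod (w : C) : `|complex.Re w| <= cmod w.
Proof. by have := normc_ge_Re w; rewrite normc_def lecR; case: w. Qed.

Lemma Im_le_cmod (w : C) : `|complex.Im w| <= cmod w.
Proof.
have := normc_ge_Re (w * 'i%C); rewrite ReiNIm normrN => /le_trans;
  rewrite -lecR => -> //.
rewrite !normc_def lecR; case: w => a b /=; simpc => /=.
by rewrite sqrrN addrC.
Qed.

Lemma worm_coord_bounded (z : 'rV[C]_3) : W z -> forall j, cmod (z 0 j) < Ap + 2.
Proof.
move=> Wz; have [z1 z2 h] := Wz.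
have eta1 := worm_eta_lt1 Wz; have [sp sm] := worm_eta_bounds eta1.
have Ap0 : 0 < Ap by case/andP: BAp => b0 bA; exact: lt_trans bA.
have bd w : cmod w ^+ 2 < Ap ^+ 2 -> cmod w < Ap + 2.
  by rewrite ltr_pXn2r ?nnegrE ?cmod_ge0 ?ltW// => /lt_trans; apply; rewrite ltrDl.
rewrite expR_logsq// expR_logsq// in sp.
have s1 := sqr_ge0 (cmod (z 0 1)); have s2 := sqr_ge0 (cmod (z 0 2)).
case=> [[|[|[|//]]] hj].
- rewrite (_ : Ordinal hj = 0); last exact: val_inj.
  set e := expi (logsq (z 0 1 * z 0 2)).
  have -> : z 0 0 = (z 0 0 - e) + e by rewrite subrK.
  apply: (le_lt_trans (le_normcD _ _)); rewrite cmod_expi.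
  have : cmod (z 0 0 - e) ^+ 2 < 1.
    apply: (lt_le_trans h); rewrite gerBl; exact: worm_eta_ge0.
  rewrite expr_lt1 ?cmod_ge0// => h1; lra.
- by rewrite (_ : Ordinal hj = 1); [apply: bd; lra|exact: val_inj].
- by rewrite (_ : Ordinal hj = 2); [apply: bd; lra|exact: val_inj].
Qed.

(** The sum of the inverses stays below A_-^2, so the worm keeps away from the
    coordinate axes. *)
Lemma worm_axes_away (z : 'rV[C]_3) : W z ->
  Am ^- 2 <= cmod (z 0 1) ^+ 2 /\ Am ^- 2 <= cmod (z 0 2) ^+ 2.
Proof.
move=> Wz; have [z1 z2 h] := Wz.
have eta1 := worm_eta_lt1 Wz; have [_ sm] := worm_eta_bounds eta1.
have Am0 : 0 < Am by case/andP: BAm => b0 bA; exact: lt_trans bA.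
have e2 := expR_gt0 (- logsq (z 0 1)); have e3 := expR_gt0 (- logsq (z 0 2)).
by split; rewrite -expR_logsq//; apply: expR_ge_inv => //; lra.
Qed.

Lemma compact_square (M : R) :
  compact [set w : C | `|complex.Re w| <= M /\ `|complex.Im w| <= M].
Proof.
have c : compact (`[- M, M]%classic `*` `[- M, M]%classic) by apply: compact_setX;
  exact: segment_compact.
have cf : continuous (fun q : R * R => (q.1 +i* q.2)%C : C).
  by move=> q; apply: cvg_complex => /=; [exact: cvg_fst|exact: cvg_snd].
rewrite (_ : [set w | _] = (fun q : R * R => (q.1 +i* q.2)%C : C) @`
  (`[- M, M]%classic `*` `[- M, M]%classic)).
  by apply: continuous_compact => //; exact: continuous_subspaceT.
apply/seteqP; split => [[a b] /= [ha hb]|_ [[a b] /= [ha hb]] <-] /=.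
  by exists (a, b) => //=; rewrite !in_itv/= -!ler_norml.
by move: ha hb; rewrite !in_itv/= -!ler_norml.
Qed.

Lemma closure_worm_off_axes : closure W `<=` off_axes.
Proof.
have Am0 : 0 < Am by case/andP: BAm => b0 bA; exact: lt_trans bA.
have m0 : 0 < Am ^- 2 by rewrite invr_gt0 exprn_gt0.
have far (j : 'I_3) : closed [set z : 'rV[C]_3 | Am ^- 2 <= cmod (z 0 j) ^+ 2].
  rewrite (_ : [set z | _] = (fun z : 'rV[C]_3 => cmod (z 0 j) ^+ 2) @^-1`
    [set x | Am ^- 2 <= x])//.
  by apply: closed_comp; [move=> z _;
    exact: cmod_sqr_coord_continuous|exact: closed_ge].
have nz (w : C) : Am ^- 2 <= cmod w ^+ 2 -> w != 0.
  move=> h; apply/eqP => w0; move: h; rewrite w0 ComplexField.Normc.normc0 expr0n/=.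
  by rewrite leNgt m0.
have clj (j : 'I_3) : W `<=` [set z : 'rV[C]_3 | Am ^- 2 <= cmod (z 0 j) ^+ 2] ->
    closure W `<=` [set z : 'rV[C]_3 | z 0 j != 0].
  by move=> Wj z /(closure_subset Wj); rewrite -(closure_id _).1// => /nz.
by move=> z clz; split; [apply: (clj 1) clz|apply: (clj 2) clz] =>
  y /worm_axes_away[].
Qed.

(** The log of the gap tends to -oo at the boundary, and the closure of the worm
    is a compact set off the axes. *)
Lemma compact_sublevel (c : R) : compact [set z | W z /\ - ln (gap_ z) <= c].
Proof.
pose B := [set z : 'rV[C]_3 | forall j,
  [set w : C | `|complex.Re w| <= Ap + 2 /\ `|complex.Im w| <= Ap + 2] (z 0 j)].
have cB : compact B by exact: (@rV_compact C 3 (fun=> _)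
  (fun=> @compact_square (Ap + 2))).
apply: (subclosed_compact _ cB); last first.
  move=> z [Wz _] j; have := ltW (worm_coord_bounded Wz j) => h.
  by split; apply: le_trans h; [exact: Re_le_cmod|exact: Im_le_cmod].
move=> z clz.
have [z1 z2] : off_axes z by apply: closure_worm_off_axes;
  apply: closure_subset clz => y [].
have cg : {for z, continuous gap_} by apply: worm_gap_continuous.
have gz : expR (- c) <= gap_ z.
  rewrite leNgt; apply/negP => gz.
  have : nbhs z (gap_ @^-1` [set x | x < expR (- c)]).
    by apply: cg; apply: open_nbhs_nbhs; split=> //; exact: open_lt.
  move=> /clz[y [[+ hy] /=]]; rewrite wormE => -[y1 y2 gy].
  rewrite ltNge => /negP; apply.
  by rewrite -[gap_ y]lnK ?posrE// ler_expR lerNl.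
have g0 : 0 < gap_ z by apply: lt_le_trans gz; rewrite expR_gt0.
split; first by rewrite wormE.
by rewrite lerNl -ler_expR lnK.
Qed.

Hypothesis cp_large : 4 * Ap ^+ 2 + 2 * Ap ^+ 4 * Am ^+ 2 <= cp.
Hypothesis cm_large : 4 * Am ^+ 2 + 2 * Am ^+ 4 * Ap ^+ 2 <= cm.

(** The lower bounds for e^(+-t_j) that the estimate for one cutoff requires come
    from the other cutoff. *)
Lemma gap_levi_form_worm (a1 a2 t2 t3 b1 b2 p1 p2 q1 q2 : R) :
  worm_eta Ap Bp cp Am Bm cm t2 t3 < 1 -> 0 < gap H K a1 a2 t2 t3 ->
  gap H K a1 a2 t2 t3 * (gap2 H K a1 a2 t2 t3 b1 b2 p1 q1 + gap2 H K a1 a2 t2 t3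
    (- b2) b1 p2 q2)
  <= gap1 H K a1 a2 t2 t3 b1 b2 p1 q1 ^+ 2 + gap1 H K a1 a2 t2 t3 (- b2) b1 p2 q2 ^+
    2.
Proof.
move=> /worm_eta_bounds[sp sm] g0.
have Ap0 : 0 < Ap by case/andP: BAp => b0 bA; exact: lt_trans bA.
have Am0 : 0 < Am by case/andP: BAm => b0 bA; exact: lt_trans bA.
have [e2 e3] : expR t2 < Ap ^+ 2 /\ expR t3 < Ap ^+ 2.
  by have := expR_gt0 t2; have := expR_gt0 t3; lra.
have [f2 f3] : expR (- t2) < Am ^+ 2 /\ expR (- t3) < Am ^+ 2.
  by have := expR_gt0 (- t2); have := expR_gt0 (- t3); lra.
have big (A A' c : R) : 0 < A -> 0 < A' -> 4 * A ^+ 2 + 2 * A ^+ 4 * A' ^+ 2 <= c ->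
    4 * A ^+ 2 <= c /\ 2 * A ^+ 4 <= c * A' ^- 2.
  move=> A0 A'0 h.
  have x1 : 0 < A ^+ 2 by rewrite exprn_gt0.
  have x2 : 0 < 2 * A ^+ 4 * A' ^+ 2 by rewrite !mulr_gt0 ?exprn_gt0.
  by split; [lra|rewrite ler_pdivlMr ?exprn_gt0//; lra].
have [P1 P2] := big _ _ _ Ap0 Am0 cp_large; have [M1 M2] :=
  big _ _ _ Am0 Ap0 cm_large.
apply: gap_levi_form => //.
- apply: (@cutoff_twisted_laplacian_ge0 R Ap Bp cp (Am ^- 2)) => //.
  + by rewrite invr_gt0 exprn_gt0.
  + exact: expR_ge_inv.
  + exact: expR_ge_inv.
  + ring.
- apply: (@cutoff_twisted_laplacian_ge0 R Am Bm cm (Ap ^- 2)) => //.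
  + by rewrite invr_gt0 exprn_gt0.
  + by apply: expR_ge_inv => //; rewrite opprK.
  + by apply: expR_ge_inv => //; rewrite opprK.
  + ring.
Qed.

Lemma laplacian_oppln_ge0 (L1 Li P D1 Di S1 Si : R) :
  L1 = (D1 ^+ 2 - P * S1) / P ^+ 2 -> Li = (Di ^+ 2 - P * Si) / P ^+ 2 ->
  P * (S1 + Si) <= D1 ^+ 2 + Di ^+ 2 -> 0 <= L1 + Li.
Proof. by move=> -> -> h; rewrite -mulrDl divr_ge0 ?sqr_ge0//; lra. Qed.

Lemma psh_worm : continuous_psh W (fun z => - ln (gap_ z)).
Proof.
have uc z : W z -> {for z, continuous (fun z => - ln (gap_ z))}.
  rewrite wormE => -[z1 z2 g0].
  have c1 := worm_gap_continuous (Ap := Ap) (Bp := Bp) (Am := Am) (Bm := Bm) cp0 cm0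
    (conj z1 z2).
  exact: (cvgN (continuous_comp c1 (continuous_ln g0))).
split=> // z w disc.
(* the point of the line, then the jets of its coordinates *)
pose phi (zeta : 'rV[C]_1) := z + cexp (zeta 0 0) *: w.
have Wphi zeta : left_half_plane zeta -> W (phi zeta).
  rewrite /left_half_plane /= => y0; apply: disc.
  rewrite ComplexField.Normc.normcM cmod_expi mulr1 cmod_real ger0_norm ?expR_ge0//.
  by rewrite -expR0 ler_expR ltW.
have oL := @open_left_half_plane R.
have Re_phi j zeta : complex.Re (phi zeta 0 j) = cre (z 0 j) (w 0 j) zeta
  by rewrite !mxE.
have Im_phi j zeta : complex.Im (phi zeta 0 j) = cim (z 0 j) (w 0 j) zeta
  by rewrite !mxE.
have logsq_phi j zeta : logsq (phi zeta 0 j) = lsq (z 0 j) (w 0 j) zeta.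
  by rewrite /logsq cmod_sqr Re_phi Im_phi.
pose a1 := cre (z 0 0) (w 0 0); pose a2 := cim (z 0 0) (w 0 0).
pose b1 := vre (w 0 0); pose b2 := vim (w 0 0).
pose t2 := lsq (z 0 1) (w 0 1); pose t3 := lsq (z 0 2) (w 0 2).
pose p1 := d1_lsq (z 0 1) (w 0 1); pose q1 := d1_lsq (z 0 2) (w 0 2).
pose p2 := di_lsq (z 0 1) (w 0 1); pose q2 := di_lsq (z 0 2) (w 0 2).
pose p' := d11_lsq (z 0 1) (w 0 1); pose q' := d11_lsq (z 0 2) (w 0 2).
have gapE zeta : gap_ (phi zeta) = gap H K (a1 zeta) (a2 zeta) (t2 zeta) (t3 zeta).
  by rewrite /worm_gap Re_phi Im_phi !logsq_phi.
pose P zeta := gap H K (a1 zeta) (a2 zeta) (t2 zeta) (t3 zeta).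
have P0 zeta : left_half_plane zeta -> 0 < P zeta.
  by move=> /Wphi; rewrite wormE => -[_ _]; rewrite gapE.
have n2 zeta : left_half_plane zeta -> 0 < nsq (z 0 1) (w 0 1) zeta.
  by move=> /Wphi[h _ _]; rewrite /nsq -Re_phi -Im_phi neq0_sqr_gt0.
have n3 zeta : left_half_plane zeta -> 0 < nsq (z 0 2) (w 0 2) zeta.
  by move=> /Wphi[_ h _]; rewrite /nsq -Re_phi -Im_phi neq0_sqr_gt0.
have dH m s : is_derive s (1 : R) (H m) (H m.+1 s) by exact: is_derive_cutoffD.
have dK m s : is_derive s (1 : R) (K m) (K m.+1 s) by exact: is_derive_cutoffD.
pose D1 zeta := gap1 H K (a1 zeta) (a2 zeta) (t2 zeta) (t3 zeta) (b1 zeta) (b2 zeta)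
  (p1 zeta) (q1 zeta).
pose Di zeta := gap1 H K (a1 zeta) (a2 zeta) (t2 zeta) (t3 zeta) (- b2 zeta)
  (b1 zeta) (p2 zeta) (q2 zeta).
have dP1 zeta : left_half_plane zeta ->
  is_derive (0 : R) (1 : R) (ray zeta (pt 1 0) P) (D1 zeta).
  move=> hz.
  have := is_derive_gap dH dK (is_derive_cre1 (z 0 0) (w 0 0) zeta)
    (is_derive_cim1 (z 0 0) (w 0 0) zeta)
     (is_derive_lsq1 (n2 _ hz)) (is_derive_lsq1 (n3 _ hz)).
  by rewrite !rayE0.
have dPi zeta : left_half_plane zeta ->
  is_derive (0 : R) (1 : R) (ray zeta (pt 0 1) P) (Di zeta).
  move=> hz.
  have := is_derive_gap dH dK (is_derive_crei (z 0 0) (w 0 0) zeta)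
    (is_derive_cimi (z 0 0) (w 0 0) zeta)
     (is_derive_lsqi (n2 _ hz)) (is_derive_lsqi (n3 _ hz)).
  by rewrite !rayE0.
pose S1 zeta := gap2 H K (a1 zeta) (a2 zeta) (t2 zeta) (t3 zeta) (b1 zeta) (b2 zeta)
  (p1 zeta) (q1 zeta)
  + gap1 H K (a1 zeta) (a2 zeta) (t2 zeta) (t3 zeta) (b1 zeta) (b2 zeta) (p' zeta)
      (q' zeta).
pose Si zeta := gap2 H K (a1 zeta) (a2 zeta) (t2 zeta) (t3 zeta) (- b2 zeta)
  (b1 zeta) (p2 zeta) (q2 zeta)
  + gap1 H K (a1 zeta) (a2 zeta) (t2 zeta) (t3 zeta) (- b1 zeta) (- b2 zeta)
      (- p' zeta) (- q' zeta).
have dD1 zeta : left_half_plane zeta ->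
  is_derive (0 : R) (1 : R) (ray zeta (pt 1 0) D1) (S1 zeta).
  move=> hz.
  have := @is_derive_gap1 R H K dH dK (ray zeta (pt 1 0) a1) (ray zeta (pt 1 0) a2)
    (ray zeta (pt 1 0) t2) (ray zeta (pt 1 0) t3) (ray zeta (pt 1 0) b1)
      (ray zeta (pt 1 0) b2)
    (ray zeta (pt 1 0) p1) (ray zeta (pt 1 0) q1) 0 (b1 zeta) (b2 zeta) (p' zeta)
      (q' zeta).
  rewrite !rayE0; apply.
  - exact: is_derive_cre1.
  - exact: is_derive_cim1.
  - exact: is_derive_lsq1 (n2 _ hz).
  - exact: is_derive_lsq1 (n3 _ hz).
  - exact: is_derive_vre1.
  - exact: is_derive_vim1.
  - exact: is_derive_lsq11 (n2 _ hz).
  - exact: is_derive_lsq11 (n3 _ hz).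
have dDi zeta : left_half_plane zeta ->
  is_derive (0 : R) (1 : R) (ray zeta (pt 0 1) Di) (Si zeta).
  move=> hz.
  have := @is_derive_gap1 R H K dH dK (ray zeta (pt 0 1) a1) (ray zeta (pt 0 1) a2)
    (ray zeta (pt 0 1) t2) (ray zeta (pt 0 1) t3) (fun t => - ray zeta (pt 0 1) b2 t)
      (ray zeta (pt 0 1) b1)
    (ray zeta (pt 0 1) p2) (ray zeta (pt 0 1) q2) 0 (- b1 zeta) (- b2 zeta)
      (- p' zeta) (- q' zeta).
  rewrite !rayE0; apply.
  - exact: is_derive_crei.
  - exact: is_derive_cimi.
  - exact: is_derive_lsqi (n2 _ hz).
  - exact: is_derive_lsqi (n3 _ hz).
  - exact: (is_deriveN (is_derive_vimi (w 0 0) zeta)).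
  - exact: is_derive_vrei.
  - exact: is_derive_lsqii (n2 _ hz).
  - exact: is_derive_lsqii (n3 _ hz).
have GE : (fun zeta : 'rV[C]_1 => - ln (gap_ (z + cexp (zeta 0 0) *: w))) =
  (fun zeta => - ln (P zeta)).
  by apply/funext => zeta; rewrite -[z + _]/(phi zeta) gapE.
apply: (@sub_mean_value R 3 W (fun z => - ln (gap_ z)) z w uc disc); rewrite GE.
  apply: (eq_Ck_on (f := fun zeta => - ln (gap_ (phi zeta))) oL).
    by move=> zeta _; rewrite gapE.
  apply: (Ck_on_opp oL); apply: (Ck_on_ln oL).
    by move=> zeta hz; rewrite gapE; exact: P0.
  apply: (Ck_on_worm_gap (phi := phi) _ _ _ _ cp0 cm0 oL).
  - move=> zeta /Wphi[h1 h2 _]; exact: (conj h1 h2).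
  - by move=> j; under eq_fun do rewrite Re_phi; exact: Ck_on_cre.
  - by move=> j; under eq_fun do rewrite Im_phi; exact: Ck_on_cim.
move=> zeta hz.
have dG v (D : 'rV[C]_1 -> R) :
    (forall zeta, left_half_plane zeta ->
      is_derive (0 : R) (1 : R) (ray zeta v P) (D zeta)) ->
    forall zeta, left_half_plane zeta ->
      is_derive (0 : R) (1 : R) (ray zeta v (fun zeta => - ln (P zeta)))
        (- (D zeta / P zeta)).
  move=> dP eta heta; have := is_derive_oppln _ (dP eta heta).
  by rewrite rayE0; apply; exact: P0.
have ddG v (D : 'rV[C]_1 -> R) s :
    (forall zeta, left_half_plane zeta ->
      is_derive (0 : R) (1 : R) (ray zeta v P) (D zeta)) ->
    is_derive (0 : R) (1 : R) (ray zeta v D) s ->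
    rderive (rderive (fun zeta => - ln (P zeta)) ^~ v) zeta v =
      (D zeta ^+ 2 - P zeta * s) / P zeta ^+ 2.
  move=> dP dD; apply: (second_rderive oL (dG v D dP) hz).
  have Pn0 : P zeta != 0 := lt0r_neq0 (P0 _ hz).
  have := @is_derive_divf R (ray zeta v D) (ray zeta v P) 0 s (D zeta).
  rewrite !rayE0 => /(_ Pn0 dD (dP zeta hz)) /is_deriveN; move/is_derive_eq; apply.
  by move: (P zeta) (D zeta) Pn0 => x y x0; field.
have e1 := ddG _ _ _ dP1 (dD1 _ hz); have ei := ddG _ _ _ dPi (dDi _ hz).
apply: (laplacian_oppln_ge0 e1 ei).
have eta1 := worm_eta_lt1 (Wphi _ hz); rewrite !logsq_phi in eta1.
have h := gap_levi_form_worm (b1 zeta) (b2 zeta) (p1 zeta) (p2 zeta) (q1 zeta)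
  (q2 zeta) eta1 (P0 _ hz).
(* the coordinates are harmonic, so that only the quadratic parts remain *)
have S0 : gap1 H K (a1 zeta) (a2 zeta) (t2 zeta) (t3 zeta) (b1 zeta) (b2 zeta)
  (p' zeta) (q' zeta) +
    gap1 H K (a1 zeta) (a2 zeta) (t2 zeta) (t3 zeta) (- b1 zeta) (- b2 zeta)
      (- p' zeta) (- q' zeta) = 0.
  by rewrite gap1D !subrr gap10.
by rewrite /S1 /Si addrACA S0 addr0; exact: h.
Qed.

Theorem pseudoconvex_worm : pseudoconvex W.
Proof.
by exists (fun z => - ln (gap_ z)); split; [exact: psh_worm|exact: compact_sublevel].
Qed.

End WormPseudoconvex.

(** * Polar form and convexity of the exponential *)

Section PolarCoordinates.
Context {R : realType}.
Local Notation C := (R[i]).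

Lemma unit_circle_expi (a b : R) :
  a ^+ 2 + b ^+ 2 = 1 -> exists alpha, expi alpha = (a +i* b)%C.
Proof.
move=> ab1.
have a1 : a ^+ 2 <= 1 by rewrite -ab1 lerDl sqr_ge0.
have aI : -1 <= a <= 1 by apply/andP; split; nra.
have sb : sin (acos a) = `|b|.
  by rewrite sin_acos// -ab1 addrAC subrr add0r sqrtr_sqr.
have ca : cos (acos a) = a by rewrite acosK// in_itv/=.
case: (leP 0 b) => b0.
  by exists (acos a); rewrite /expi ca sb ger0_norm.
by exists (- acos a); rewrite /expi cosN sinN ca sb ltr0_norm// opprK.
Qed.

Lemma polar_form (w : C) : w != 0 ->
  exists alpha, w = (expR (logsq w / 2))%:C%C * expi alpha.
Proof.
move=> w0; pose m := expR (logsq w / 2).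
have m2 : m ^+ 2 = cmod w ^+ 2.
  by rewrite /m -expRM_natl mulrC divfK ?expR_logsq.
have m0 : m != 0 by rewrite gt_eqF// expR_gt0.
have [|al hal] := @unit_circle_expi (complex.Re w / m) (complex.Im w / m).
  by rewrite !expr_div_n -mulrDl -cmod_sqr -m2 divff// expf_neq0.
exists al; rewrite hal -/m; case: w {w0 hal m2} @m m0 => a b m m0.
by simpc; congr (_ +i* _)%C; rewrite mulrC divfK.
Qed.

(** Convexity between 0 and t, from the tangent inequality e^s >= 1 + s at
    s = (1 - r) t and s = - r t. *)
Lemma expR_convex (r t : R) : 0 <= r <= 1 -> expR (r * t) <= 1 - r + r * expR t.
Proof.
move=> /andP[r0 r1]; have e0 := expR_gt0 (r * t).
have h1 : expR (r * t) * (1 + (1 - r) * t) <= expR t.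
  have -> : expR t = expR (r * t) * expR ((1 - r) * t) by rewrite -expRD; congr expR;
    ring.
  by rewrite ler_pM2l// expR_ge1Dx.
have h2 : expR (r * t) * (1 - r * t) <= 1.
  have e1 : expR (r * t) * expR (- (r * t)) = 1 by rewrite -expRD subrr expR0.
  by rewrite -[leRHS]e1 ler_pM2l// expR_ge1Dx.
have h3 : r * (expR (r * t) * (1 + (1 - r) * t)) <= r * expR t by rewrite ler_wpM2l.
have h4 : (1 - r) * (expR (r * t) * (1 - r * t)) <= (1 - r) * 1
  by rewrite ler_wpM2l// subr_ge0.
move: h3 h4; set e := expR (r * t); nra.
Qed.

Lemma expR_mul_ge (t : R) : expR t - 1 <= expR t * t.
Proof.
have e0 := expR_gt0 t.
have h : expR t * (1 - t) <= 1.
  have e1 : expR t * expR (- t) = 1 by rewrite -expRD subrr expR0.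
  by rewrite -[leRHS]e1 ler_pM2l// expR_ge1Dx.
by move: h; rewrite mulrBr mulr1; lra.
Qed.

End PolarCoordinates.

(** * The worm is a bounded domain *)

Section WormDomain.
Context {R : realType}.
Local Notation C := (R[i]).
Variables (Ap Bp cp Am Bm cm : R).
Hypothesis BAp : 0 < Bp < Ap.
Hypothesis BAm : 0 < Bm < Am.
Hypothesis cp0 : 0 < cp.
Hypothesis cm0 : 0 < cm.
Hypothesis Bp2 : 2 <= Bp ^+ 2.
Hypothesis Bm2 : 2 <= Bm ^+ 2.

Local Notation W := (worm (worm_eta Ap Bp cp Am Bm cm)).
Local Notation gap_ := (worm_gap Ap Bp cp Am Bm cm).
Local Notation H := (cutoffD Ap Bp cp).
Local Notation K := (cutoffD Am Bm cm).
Local Notation eta := (worm_eta Ap Bp cp Am Bm cm).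

(** On the segment from 0 the sum is at most a convex combination of 2 <= B^2 and
    of its value at the end, and the cutoff vanishes below B^2. *)
Lemma cutoff_ray_le (A B c r t2 t3 : R) : 0 < c -> 2 <= B ^+ 2 -> 0 <= r <= 1 ->
  cutoff A B c (expR (r * t2) + expR (r * t3)) <= cutoff A B c (expR t2 + expR t3).
Proof.
move=> c0 B2 r01; have /andP[r0 r1] := r01.
have h2 := expR_convex t2 r01; have h3 := expR_convex t3 r01.
case: (leP (expR t2 + expR t3) (B ^+ 2)) => hs.
  rewrite [leLHS]cutoff_le ?cutoff_ge0//.
  have : r * (expR t2 + expR t3) <= r * B ^+ 2 by rewrite ler_wpM2l.
  have : (1 - r) * 2 <= (1 - r) * B ^+ 2 by rewrite ler_wpM2l// subr_ge0.
  lra.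
apply: cutoff_homo => //.
have : (1 - r) * 2 <= (1 - r) * (expR t2 + expR t3) by rewrite ler_wpM2l ?subr_ge0//;
  lra.
lra.
Qed.

Lemma worm_eta_ray_le (r t2 t3 : R) :
  0 <= r <= 1 -> eta (r * t2) (r * t3) <= eta t2 t3.
Proof.
by move=> r01; rewrite /worm_eta -!mulrN lerD// cutoff_ray_le.
Qed.

(** Polar coordinates centred at a = e^(i theta) show that the worm is the image of
    a set that is star-shaped about the origin; each point is joined to (1, 1, 1)
    by the image of the corresponding segment. *)
Lemma connected_worm : connected W.
Proof.
have path (z : 'rV[C]_3) : W z -> exists g : R -> 'rV[C]_3,
    [/\ continuous g, g 0 = const_mx 1, g 1 = z & forall r, 0 <= r <= 1 -> W (g r)].
  move=> [z1 z2 h].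
  have [al hal] := polar_form z1; have [be hbe] := polar_form z2.
  set t2 := logsq (z 0 1) in hal; set t3 := logsq (z 0 2) in hbe.
  pose d := z 0 0 - expi (t2 + t3).
  pose g0 r := (expi (r * (t2 + t3)) + r%:C%C * d : C).
  pose g1 r := ((expR (r * t2 / 2))%:C%C * expi (r * al) : C).
  pose g2 r := ((expR (r * t3 / 2))%:C%C * expi (r * be) : C).
  pose g r : 'rV[C]_3 := \row_(j < 3) [:: g0 r; g1 r; g2 r]`_j.
  have gE r : [/\ g r 0 0 = g0 r, g r 0 1 = g1 r & g r 0 2 = g2 r] by rewrite /g !mxE.
  have modE (t a : R) : cmod ((expR (t / 2))%:C%C * expi a) ^+ 2 = expR t.
    rewrite ComplexField.Normc.normcM cmod_expi mulr1 cmod_real real_normK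
      ?num_real//.
    by rewrite -expRM_natl mulrC divfK.
  have nz (w : C) (t : R) : cmod w ^+ 2 = expR t -> w != 0.
    move=> e; apply/eqP => w0; move: e; rewrite w0 ComplexField.Normc.normc0 expr0n/=.
    by move=> /eqP; rewrite lt_eqF ?expR_gt0.
  exists g; split.
  - have cl (a : R) : continuous (fun r : R => r * a) by move=> r; apply: cvgMl;
      exact: cvg_id.
    have cc (a : R) : continuous (fun r : R => cos (r * a)).
      by move=> r; exact: (continuous_comp (cl a r) (@continuous_cos R (r * a))).
    have cs (a : R) : continuous (fun r : R => sin (r * a)).
      by move=> r; exact: (continuous_comp (cl a r) (@continuous_sin R (r * a))).
    have ce (a : R) : continuous (fun r : R => expR (r * a / 2)).
      move=> r; have c1 : {for r, continuous (fun s : R => s * a / 2)}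
        by apply: cvgMl; exact: cl.
      exact: (continuous_comp c1 (@continuous_expR R (r * a / 2))).
    have cpol (t a : R) : continuous
      (fun r : R => (expR (r * t / 2))%:C%C * expi (r * a) : C).
      move=> r; apply: cvg_complex.
        rewrite Re_realM; under eq_fun do rewrite Re_realM.
        by apply: cvgM; [exact: ce|exact: cc].
      rewrite Im_realM; under eq_fun do rewrite Im_realM.
      by apply: cvgM; [exact: ce|exact: cs].
    have c0 : continuous g0.
      move=> r; rewrite /g0; apply: cvg_complex; under eq_fun do rewrite raddfD/=.
        rewrite raddfD/= Re_realM; under eq_fun do rewrite Re_realM.
        by apply: cvgD; [exact: cc|exact: cl].
      rewrite raddfD/= Im_realM; under eq_fun do rewrite Im_realM.
      by apply: cvgD; [exact: cs|exact: cl].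
    move=> r; apply: cvg_row => j; rewrite mxE; under eq_fun do rewrite mxE.
    case: j => [[|[|[|//]]] hj] /=; [exact: c0|exact: cpol|exact: cpol].
  - have e0 : expi 0 = 1 :> C by rewrite /expi cos0 sin0.
    apply/rowP => j; rewrite !mxE /g0 /g1 /g2 !mul0r expR0 e0 mul1r addr0.
    by case: j => [[|[|[|//]]] hj].
  - apply/rowP => j; rewrite mxE /g0 /g1 /g2 !mul1r -hal -hbe /d [_ + (_ - _)]addrC
      subrK.
    case: j => [[|[|[|//]]] hj] /=; by congr (z _ _); apply: val_inj.
  - move=> r r01; have [e0 e1 e2] := gE r; rewrite /worm /= e0 e1 e2.
    have m1 := modE (r * t2) (r * al); have m2 := modE (r * t3) (r * be).
    split; [exact: nz m1|exact: nz m2|].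
    rewrite -!/(logsq _) logsqM; [|exact: nz m1|exact: nz m2].
    rewrite /logsq m1 m2 !expRK -mulrDr.
    have -> : g0 r - expi (r * (t2 + t3)) = r%:C%C * d
      by rewrite /g0 addrAC subrr add0r.
    rewrite ComplexField.Normc.normcM cmod_real exprMn [`|r| ^+ 2]real_normK;
      last exact: num_real.
    have /andP[r0 r1] := r01.
    apply: (@le_lt_trans _ _ (cmod d ^+ 2)).
      by rewrite -[leRHS]mul1r ler_wpM2r ?sqr_ge0// expr_le1.
    have : cmod d ^+ 2 < 1 - eta t2 t3 by move: h; rewrite -!/(logsq _) logsqM.
    by move=> /lt_le_trans; apply; rewrite lerB// worm_eta_ray_le.
rewrite (_ : W = \bigcup_(g in [set g : R ->
  'rV[C]_3 | [/\ continuous g, g 0 = const_mx 1 & forall r, 0 <= r <= 1 -> W (g r)]])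
  (g @` `[0, 1]%classic)).
  apply: bigcup_connected.
    exists (const_mx 1) => g [_ g0 _]; exists 0 => //=;
      by rewrite in_itv/= lexx ler01.
  move=> g [cg _ _]; apply: connected_continuous_connected;
    first exact: segment_connected.
  exact: continuous_subspaceT.
apply/seteqP; split => [z Wz|z [g [_ _ gW] [r rI <-]]].
  have [g [cg g0 g1 gW]] := path z Wz; exists g => //.
  by exists 1 => //=; rewrite in_itv/= lexx ler01.
by apply: gW; move: rI; rewrite /= in_itv.
Qed.

Lemma worm_nonempty : W !=set0.
Proof.
exists (const_mx 1); rewrite /worm /= !mxE mulr1 oner_neq0 /logsq.
rewrite ComplexField.Normc.normc1 expr1n ln1 /expi cos0 sin0 -[(1 +i* 0)%C]/(1 : C)
  subrr.
rewrite ComplexField.Normc.normc0 expr0n /= /worm_eta oppr0 expR0 !cutoff_le//.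
by rewrite addr0 subr0 ltr01.
Qed.

Lemma bounded_worm : bounded_set W.
Proof.
exists ((Ap + 2)%:C)%C; split; first by apply/complex_realP; exists (Ap + 2).
move=> x hx z Wz; apply: le_trans (ltW hx).
rewrite -[`|z|]/(mx_norm z).
have [->|n0] := eqVneq (mx_norm z) 0.
  by rewrite ler0c; case/andP: BAp => b0 bA; rewrite ltW// addr_gt0// (lt_trans b0).
have [[i j] /= ->] := mx_norm_neq0 n0.
rewrite (ord1 i) normc_def lecR; apply: ltW.
by have := worm_coord_bounded BAp BAm cp0 cm0 Wz j; case: (z 0 j).
Qed.

End WormDomain.

(** * Smoothness of the boundary *)

Section WormBoundary.
Context {R : realType}.
Local Notation C := (R[i]).
Variables (Ap Bp cp Am Bm cm : R).
Hypothesis BAp : 0 < Bp < Ap.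
Hypothesis BAm : 0 < Bm < Am.
Hypothesis cp0 : 0 < cp.
Hypothesis cm0 : 0 < cm.
Hypothesis Bp2 : 2 <= Bp ^+ 2.
Hypothesis Bm2 : 2 <= Bm ^+ 2.

Local Notation W := (worm (worm_eta Ap Bp cp Am Bm cm)).
Local Notation gap_ := (worm_gap Ap Bp cp Am Bm cm).
Local Notation H := (cutoffD Ap Bp cp).
Local Notation K := (cutoffD Am Bm cm).
Local Notation eta := (worm_eta Ap Bp cp Am Bm cm).

Lemma boundary_worm_gap z : boundary W z -> off_axes z /\ gap_ z = 0.
Proof.
move=> [clz niz]; have oz := closure_worm_off_axes BAp BAm cp0 cm0 clz; split=> //.
have cg := worm_gap_continuous (Ap := Ap) (Bp := Bp) (Am := Am) (Bm := Bm) cp0 cm0 oz.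
case: (ltgtP (gap_ z) 0) => // g0; exfalso.
- have : nbhs z (gap_ @^-1` [set x | x < 0]).
    by apply: cg; apply: open_nbhs_nbhs; split=> //; exact: open_lt.
  move=> /clz[y [Wy /=]]; move: Wy; rewrite wormE => -[_ _ gy] gy'.
  by have := lt_trans gy gy'; rewrite ltxx.
- apply: niz; have := @open_worm R Ap Bp cp Am Bm cm cp0 cm0; rewrite openE; apply.
  by rewrite wormE; case: oz => z1 z2; split.
Qed.

Lemma is_derive_ray_Re n (z v : 'rV[C]_n) j :
  is_derive (0 : R) (1 : R) (ray z v (fun z => complex.Re (z 0 j)))
    (complex.Re (v 0 j)).
Proof.
have -> : ray z v (fun z => complex.Re (z 0 j)) =
  (fun t => complex.Re (z 0 j) + t * complex.Re (v 0 j)).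
  by apply/funext => t; rewrite /ray !mxE raddfD/= Re_realM.
by apply: is_derive_eq; rewrite /GRing.scale/=; ring.
Qed.

Lemma is_derive_ray_Im n (z v : 'rV[C]_n) j :
  is_derive (0 : R) (1 : R) (ray z v (fun z => complex.Im (z 0 j)))
    (complex.Im (v 0 j)).
Proof.
have -> : ray z v (fun z => complex.Im (z 0 j)) =
  (fun t => complex.Im (z 0 j) + t * complex.Im (v 0 j)).
  by apply/funext => t; rewrite /ray !mxE raddfD/= Im_realM.
by apply: is_derive_eq; rewrite /GRing.scale/=; ring.
Qed.

Lemma is_derive_ray_logsq n (z v : 'rV[C]_n) j (k : R) :
  z 0 j != 0 -> v 0 j = k%:C%C * z 0 j ->
  is_derive (0 : R) (1 : R) (ray z v (fun z => logsq (z 0 j))) (2 * k).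
Proof.
move=> zj vj; have n0 := neq0_sqr_gt0 zj.
have -> : ray z v (fun z => logsq (z 0 j)) =
    (fun t => ln (ray z v (fun z => complex.Re (z 0 j)) t ^+ 2 + ray z v
      (fun z => complex.Im (z 0 j)) t ^+ 2)).
  by apply/funext => t; rewrite /ray /logsq cmod_sqr.
have := @is_derive_lsq R _ _ 0 _ _ _ (is_derive_ray_Re z v j)
  (is_derive_ray_Im z v j).
rewrite !rayE0 vj Re_realM Im_realM => /(_ n0); move/is_derive_eq; apply.
move: n0; move: (complex.Re _) (complex.Im _) => a b /lt0r_neq0 n0; by field.
Qed.

Lemma rderive_oppgap (z v : 'rV[C]_3) (k2 k3 : R) : off_axes z ->
  v 0 1 = k2%:C%C * z 0 1 -> v 0 2 = k3%:C%C * z 0 2 ->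
  rderive (fun z => - gap_ z) z v =
  - gap1 H K (complex.Re (z 0 0)) (complex.Im (z 0 0)) (logsq (z 0 1)) (logsq (z 0 2))
    (complex.Re (v 0 0)) (complex.Im (v 0 0)) (2 * k2) (2 * k3).
Proof.
move=> [z1 z2] v1 v2.
have dH m s : is_derive s (1 : R) (H m) (H m.+1 s) by exact: is_derive_cutoffD.
have dK m s : is_derive s (1 : R) (K m) (K m.+1 s) by exact: is_derive_cutoffD.
have := is_derive_gap dH dK (is_derive_ray_Re z v 0) (is_derive_ray_Im z v 0)
  (is_derive_ray_logsq z1 v1) (is_derive_ray_logsq z2 v2).
rewrite !rayE0 => /is_deriveN dg.
by have [_] := rderive_def (f := fun z => - gap_ z) (z := z) (v := v) dg.
Qed.

(** The derivative of the cutoff along the ray through (t2, t3): since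
    t e^t >= e^t - 1, the sum s increases along the ray at rate at least s - 2,
    which is positive where the cutoff is not 0. *)
Lemma cutoff_radial_derivative (A B c t2 t3 : R) : 0 < c -> 2 <= B ^+ 2 ->
  0 <= cutoffD A B c 1 (expR t2 + expR t3) * (expR t2 * t2 + expR t3 * t3) /\
  (cutoff A B c (expR t2 + expR t3) != 0 ->
   0 < cutoffD A B c 1 (expR t2 + expR t3) * (expR t2 * t2 + expR t3 * t3)).
Proof.
move=> c0 B2; case: (leP (expR t2 + expR t3) (B ^+ 2)) => hs.
  by rewrite cutoffD_le// mul0r cutoff_le// eqxx.
have h2 := expR_mul_ge t2; have h3 := expR_mul_ge t3.
have pos : 0 < cutoffD A B c 1 (expR t2 + expR t3) * (expR t2 * t2 + expR t3 * t3).
  apply: mulr_gt0; last by lra.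
  by rewrite cutoffD1// mulr_gt0 ?divr_gt0 ?exprn_gt0 ?subr_gt0// cutoffE// expR_gt0.
by split=> [|_]; first exact: ltW.
Qed.

(** Move a away from e^(i theta) if it is not there already; otherwise eta = 1, so
    one of the cutoffs is positive and increases along the ray. *)
Lemma worm_gradient z : off_axes z -> gap_ z = 0 ->
  exists v, rderive (fun z => - gap_ z) z v != 0.
Proof.
move=> oz gz; have [z1 z2] := oz.
set t2 := logsq (z 0 1); set t3 := logsq (z 0 2).
pose d := z 0 0 - expi (t2 + t3).
have gE := worm_gapE Ap Bp cp Am Bm cm z1 z2; rewrite logsqM// -/t2 -/t3 -/d gz in gE.
have d1 : complex.Re d = complex.Re (z 0 0) - cos (t2 + t3) by rewrite /d raddfB.
have d2 : complex.Im d = complex.Im (z 0 0) - sin (t2 + t3) by rewrite /d raddfB.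
have [d0|d0] := eqVneq d 0.
- pose v : 'rV[C]_3 := \row_(j < 3) [:: 0; t2%:C%C * z 0 1; t3%:C%C * z 0 2]`_j.
  exists v.
  have v1 : v 0 1 = t2%:C%C * z 0 1 by rewrite /v mxE.
  have v2 : v 0 2 = t3%:C%C * z 0 2 by rewrite /v mxE.
  have v0 : v 0 0 = 0 by rewrite /v mxE.
  rewrite (rderive_oppgap oz v1 v2) -/t2 -/t3 v0 oppr_eq0.
  rewrite d0 ComplexField.Normc.normc0 expr0n/= subr0 in gE.
  rewrite d0 /= in d1 d2.
  have a1 : complex.Re (z 0 0) = cos (t2 + t3) by lra.
  have a2 : complex.Im (z 0 0) = sin (t2 + t3) by lra.
  have [hp hp'] := cutoff_radial_derivative Ap t2 t3 cp0 Bp2.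
  have [hm hm'] := cutoff_radial_derivative Am (- t2) (- t3) cm0 Bm2.
  have pos : 0 < H 1 (expR t2 + expR t3) * (expR t2 * t2 + expR t3 * t3) +
     K 1 (expR (- t2) + expR (- t3)) * (expR (- t2) * - t2 + expR (- t3) * - t3).
    have [ep|ep] := eqVneq (cutoff Ap Bp cp (expR t2 + expR t3)) 0.
      have [em|em] := eqVneq (cutoff Am Bm cm (expR (- t2) + expR (- t3))) 0.
        by move: gE; rewrite /worm_eta ep em addr0 subr0 => /eqP;
          rewrite eq_sym oner_eq0.
      by have := hm' em; lra.
    by have := hp' ep; lra.
  rewrite lt_eqF// /gap1 a1 a2 /=; move: pos; set X := H 1 _; set Y := K 1 _.
  set c := cos _; set s := sin _; nra.
- exists (\row_(j < 3) [:: d; 0; 0]`_j).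
  rewrite (@rderive_oppgap _ _ 0 0)//;
    [|by rewrite mxE/= mul0r|by rewrite mxE/= mul0r].
  rewrite -/t2 -/t3 mxE /= d1 d2 oppr_eq0 lt_eqF//.
  have := neq0_sqr_gt0 d0; rewrite d1 d2 /gap1; lra.
Qed.

Lemma smooth_boundary_worm : has_smooth_boundary W.
Proof.
exists off_axes, (fun z => - gap_ z); split.
- exact: open_off_axes.
- by move=> z /boundary_worm_gap[].
- move=> k; apply: Ck_on_opp; first exact: open_off_axes.
  exact: smooth_worm_gap.
- rewrite wormE; apply/seteqP; split => z /=.
    by move=> [[z1 z2 g0] oz]; split=> //; rewrite oppr_lt0.
  by move=> [[z1 z2] g0]; split=> //; split=> //; rewrite -oppr_lt0.
- by move=> z /boundary_worm_gap[oz gz]; exact: worm_gradient.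
Qed.

Theorem smoothly_bounded_worm : smoothly_bounded_domain W.
Proof.
split; [split|exact: bounded_worm|exact: smooth_boundary_worm].
- exact: worm_nonempty.
- exact: open_worm.
- exact: connected_worm.
Qed.

Lemma worm_box_sub (mu : R) : 2 * expR mu <= Bp ^+ 2 -> 2 * expR mu <= Bm ^+ 2 ->
  worm_box mu `<=` W.
Proof.
move=> hp hm z; rewrite worm_boxE => -[z1 z2 h /andP[a2 b2] /andP[a3 b3]].
split=> //; rewrite -!/(logsq _) in a2 b2 a3 b3 h *.
have e t : t < mu -> expR t < expR mu by rewrite ltr_expR.
have sp : expR (logsq (z 0 1)) + expR (logsq (z 0 2)) <= Bp ^+ 2.
  by have := e _ b2; have := e _ b3; lra.
have sm : expR (- logsq (z 0 1)) + expR (- logsq (z 0 2)) <= Bm ^+ 2.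
  have c2 : - logsq (z 0 1) < mu by rewrite ltrNl.
  have c3 : - logsq (z 0 2) < mu by rewrite ltrNl.
  by have := e _ c2; have := e _ c3; lra.
by rewrite /worm_eta (cutoff_le _ _ sp) (cutoff_le _ _ sm) addr0 subr0 expr_lt1
  ?cmod_ge0.
Qed.

Lemma worm_sub_box (mu : R) : 2 * ln Ap <= mu -> 2 * ln Am <= mu ->
  W `<=` worm_box mu.
Proof.
move=> hp hm z Wz; rewrite worm_boxE.
have [z1 z2 h] := Wz; have eta1 := worm_eta_lt1 Wz.
have [sp sm] := worm_eta_bounds BAp BAm cp0 cm0 eta1.
have lt_ln A t : 0 < A -> 2 * ln A <= mu -> expR t < A ^+ 2 -> t < mu.
  move=> A0 Amu ht; apply: lt_le_trans Amu.
  have -> : 2 * ln A = ln (A ^+ 2) by rewrite lnXn// mulr_natl.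
  by rewrite -ltr_expR lnK// posrE exprn_gt0.
have Ap0 : 0 < Ap by case/andP: BAp => b0 bA; exact: lt_trans bA.
have Am0 : 0 < Am by case/andP: BAm => b0 bA; exact: lt_trans bA.
rewrite -!/(logsq _) in h eta1 *.
have := expR_gt0 (logsq (z 0 1)); have := expR_gt0 (logsq (z 0 2)).
have := expR_gt0 (- logsq (z 0 1)); have := expR_gt0 (- logsq (z 0 2)) => e1 e2 e3 e4.
split=> //.
- rewrite -(expr_lt1 (n := 2)) ?cmod_ge0//; apply: lt_le_trans h _.
  by rewrite gerBl worm_eta_ge0.
- rewrite ltrNl; apply/andP; split; [apply: (lt_ln Am)|apply: (lt_ln Ap)] => //; lra.
- rewrite ltrNl; apply/andP; split; [apply: (lt_ln Am)|apply: (lt_ln Ap)] => //; lra.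
Qed.

End WormBoundary.

Theorem theorem3p11 (R : realType) (mu : R) (Ap Am Bp Bm : R)
  (mu_gt0 : 0 < mu)
  (ltBAp : Bp < Ap) (leBp : Num.sqrt (2 * expR mu) <= Bp)
  (ltBAm : Bm < Am) (leBm : Num.sqrt (2 * expR mu) <= Bm) :
  (forall cp cm : R, 0 < cp -> 0 < cm ->
     let W := worm (worm_eta Ap Bp cp Am Bm cm) in
     [/\ smoothly_bounded_domain W,
         worm_box mu `<=` W &
         forall mu' : R, 2 * ln Ap <= mu' -> 2 * ln Am <= mu' ->
           W `<=` worm_box mu']) /\
  (exists Cp : R, Ap ^+ 2 <= Cp /\
     forall cp : R, Cp < cp ->
     exists Cm : R, Am ^+ 2 <= Cm /\
       forall cm : R, Cm < cm ->
         pseudoconvex (worm (worm_eta Ap Bp cp Am Bm cm))).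
Proof.
have emu : 1 < expR mu by rewrite expR_gt1.
have sqrt_le B : Num.sqrt (2 * expR mu) <= B -> 0 < B /\ 2 * expR mu <= B ^+ 2.
  move=> h; have s0 : 0 < Num.sqrt (2 * expR mu) by rewrite sqrtr_gt0; lra.
  have B0 := lt_le_trans s0 h; split=> //.
  rewrite -[leLHS]sqr_sqrtr; last by lra.
  by rewrite ler_pXn2r ?nnegrE ?(ltW s0) ?(ltW B0).
have [Bp0 Bp2] := sqrt_le _ leBp; have [Bm0 Bm2] := sqrt_le _ leBm.
have BAp : 0 < Bp < Ap by rewrite Bp0.
have BAm : 0 < Bm < Am by rewrite Bm0.
have Ap0 := lt_trans Bp0 ltBAp; have Am0 := lt_trans Bm0 ltBAm.
have Ap2 : 0 < Ap ^+ 2 by rewrite exprn_gt0.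
have Am2 : 0 < Am ^+ 2 by rewrite exprn_gt0.
have q1 : 0 < 2 * Ap ^+ 4 * Am ^+ 2 by rewrite !mulr_gt0 ?exprn_gt0.
have q2 : 0 < 2 * Am ^+ 4 * Ap ^+ 2 by rewrite !mulr_gt0 ?exprn_gt0.
split.
  move=> cp cm cp0 cm0 W; split.
  - by apply: smoothly_bounded_worm => //; lra.
  - exact: worm_box_sub.
  - by move=> mu'; exact: worm_sub_box.
exists (4 * Ap ^+ 2 + 2 * Ap ^+ 4 * Am ^+ 2); split; first by lra.
move=> cp hcp; exists (4 * Am ^+ 2 + 2 * Am ^+ 4 * Ap ^+ 2); split; first by lra.
by move=> cm hcm; apply: pseudoconvex_worm => //; lra.
Qed.
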